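(* Let $k$ be a field of odd characteristic $p$ and let $G$ and $H$ be finite $p$-groups such that $kG\cong kH$ as $k$-algebras. If $G$ is $2$-generated and $G'$ is cyclic, then $H$ is $2$-generated, $H'$ is cyclic and $\mathcal{O}(G)=\mathcal{O}(H)$.
   Context: A group is $2$-generated if the minimum number of generators is exactly $2$. For a finite $2$-generated $p$-group $\Gamma$, a basis of $\Gamma$ is a pair $(b_1,b_2)$ of elements of $\Gamma$ such that $\Gamma/\Gamma'=\langle b_1\Gamma'\rangle\times\langle b_2\Gamma'\rangle$ and $|b_2\Gamma'|$ divides $|b_1\Gamma'|$. Define $\mathcal{O}(\Gamma)=\min_{\mathrm{lex}}\{(|b_1{\rm C}_\Gamma(\Gamma')|,\ |b_2{\rm C}_\Gamma(\Gamma')|,\ -|b_1|,\ -|b_2|) : (b_1,b_2) \text{ a basis of } \Gamma\}$, where $\min_{\mathrm{lex}}$ is the minimum for the lexicographic order on integer $4$-tuples, $|x|$ is the order of the element $x$ and $|b_i{\rm C}_\Gamma(\Gamma')|$ is the order of the coset $b_i{\rm C}_\Gamma(\Gamma')$ in $\Gamma/{\rm C}_\Gamma(\Gamma')$ (note ${\rm C}_\Gamma(\Gamma')$ is normal). *)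

(* Defs.v *)
From HB Require Import structures.
From mathcomp Require Import all_boot all_order all_algebra all_fingroup all_solvable.
Set Implicit Arguments. Unset Strict Implicit. Unset Printing Implicit Defensive.
Import GRing.Theory Num.Theory.
Local Open Scope ring_scope.

Section GroupAlgebra.
Variables (k : fieldType) (gT : finGroupType).

Definition in_galg (G : {set gT}) (a : {ffun gT -> k}) : bool :=
  [forall x, (x \notin G) ==> (a x == 0)].

Definition galg_mul (G : {set gT}) (a b : {ffun gT -> k}) : {ffun gT -> k} :=
  [ffun x => \sum_(y in G) a y * b (y^-1 * x)%g].

Definition galg_one : {ffun gT -> k} := [ffun x => (x == 1%g)%:R].
End GroupAlgebra.

Definition galg_iso (k : fieldType) (gT hT : finGroupType)
  (G : {group gT}) (H : {group hT}) : Prop :=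
  exists f : {ffun gT -> k} -> {ffun hT -> k},
  [/\ forall a, in_galg G a -> in_galg H (f a),
      forall (c : k) a b, in_galg G a -> in_galg G b ->
        f [ffun x => c * a x + b x] = [ffun y => c * f a y + f b y],
      (forall a b, in_galg G a -> in_galg G b -> f a = f b -> a = b) /\
      (forall b', in_galg H b' -> exists2 a, in_galg G a & f a = b'),
      f (galg_one k gT) = galg_one k hT
    & forall a b, in_galg G a -> in_galg G b ->
        f (galg_mul G a b) = galg_mul H (f a) (f b)].

Section Invariant.
Variable gT : finGroupType.
Implicit Type G : {group gT}.

Definition two_generated G : Prop :=
  (exists x y, [/\ x \in G, y \in G & G :=: <<[set x; y]>>%g]) /\ ~~ cyclic G.

Definition is_basis G (b : gT * gT) : bool :=
  [&& b.1 \in G, b.2 \in G,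
      (<[coset G^`(1) b.1]> \x <[coset G^`(1) b.2]> == G / G^`(1))%g
    & (#[coset G^`(1) b.2]%g %| #[coset G^`(1) b.1]%g)%N].

Definition basis_tuple G (b : gT * gT) : int * int * int * int :=
  (Posz #[coset 'C_G(G^`(1)) b.1]%g, Posz #[coset 'C_G(G^`(1)) b.2]%g,
   - Posz #[b.1]%g, - Posz #[b.2]%g).
End Invariant.

Definition lexle (s t : int * int * int * int) : bool :=
  let: (a1, a2, a3, a4) := s in
  let: (b1, b2, b3, b4) := t in
  (a1 < b1) || ((a1 == b1) && ((a2 < b2) || ((a2 == b2) &&
  ((a3 < b3) || ((a3 == b3) && (a4 <= b4)))))).

(* O(G): lexicographic minimum of the tuples over all bases
   (None if G has no basis; never happens for 2-generated p-groups). *)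
Definition Oinv (gT : finGroupType) (G : {group gT}) : option (int * int * int * int) :=
  let S := [seq basis_tuple G b | b <- enum [set b : gT * gT | is_basis G b]] in
  ohead [seq t <- S | all (lexle t) S].

(* Main.v *)
From HB Require Import structures.
Require Import Defs.
From mathcomp Require Import all_boot all_order all_algebra all_fingroup all_solvable.
From mathcomp Require Import zify.
Set Implicit Arguments. Unset Strict Implicit. Unset Printing Implicit Defensive.
Import GroupScope.

(* For a normal subgroup N of G let I(N)kG be the kernel of kG -> k[G/N], and
   call N canonical when every isomorphism kG -> kH carries I(N)kG to the ideal
   of the corresponding subgroup of H.  G' is canonical (commutator ideal), and
   so is Z(G)G' (central elements of augmentation 0).  If G' <= N is canonical
   then so is {g | g^(p^i) \in N}, because for a trace form t
     t((sum_g x_g g)^(p^i)) = sum_g x_g^(p^i) t(g^(p^i)).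
   Canonical subgroups have isomorphism-invariant indices and, since p-groups
   with cyclic derived subgroup are regular for odd p, invariant exponents.
   When G = <b, u> with u in C = C_G(G'), an element b^i u^j z (z in G') lies in
   Z(G)G' iff |G'| divides i and q = |G'|/|G:C| divides j.  Hence |G : Z(G)G'|
   determines |G:C|, and C = {g | g^q \in Z(G)G'} is canonical.
   Let (b1, b2) attain the lexicographic minimum, with |b_i G'| = N_i and
   |b_i C| = o_i.  Exchange arguments show that |b_i| is the exponent of
   {g | g^(N_i) \in G' and g^(o_i) \in C}, which is always one of G, C and
   D = {g | g^(N_2) \in G'}, and that o_1, o_2 can be read off from |G:C|,
   |DC:C| and N_1/N_2. *)

(** * Regularity of p-groups with cyclic derived subgroup *)

(** The obstacle is that kG forgets the elements of G: an isomorphism need carry neither G to H nor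
    bases to bases. Only the ideals I(N)kG can be compared, and they are tested by k-valued
    functions constant on the cosets of N. The power arguments rest on one fact: in characteristic p
    the map c -> c^(p^i) on k is additive and injective. A trace form of x^(p^i) therefore sees sums
    of coefficients of x over cosets. Taking the form to be the indicator of a coset of N, which is
    symmetric because G/N is abelian, recovers the root subgroup of N. Taking it to be the
    coefficient at 1, transported from the other algebra, recovers exponents; this needs g ->
    g^(p^i) to be constant on the cosets of N, which regularity provides. Regularity also drives the
    exchange arguments: orders satisfy |xy| <= max(|x|, |y|), so multiplying b_i by an element of
    larger order raises |b_i|. The tuple records -|b_i|, hence an admissible exchange of this kind
    contradicts minimality. *)

Section Regular.
Variables (gT : finGroupType) (G : {group gT}) (p : nat).
Hypotheses (p_odd : odd p) (pG : p.-group G) (p_pr : prime p).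
Hypothesis cycG' : cyclic G^`(1).

Lemma cyclic_der1_sub_normal (N : {group gT}) : N \subset G^`(1) -> N <| G.
Proof.
move=> sN; have cN : N \char G^`(1) by rewrite sub_cyclic_char.
exact: char_normal_trans cN (der_normal 1 G).
Qed.

Lemma cycle_cycle_expg (c : gT) (K : {group gT}) :
  p.-elt c -> K \proper <[c]> -> K \subset <[c ^+ p]>.
Proof.
move=> pc /andP[sKc nKc].
have cycK := cyclicS sKc (cycle_cyclic c).
have /cyclicP[d defK] := cycK; rewrite defK cycle_subG.
have /cycleP[i di] : d \in <[c]> by rewrite -cycle_subG -defK.
have [pi|npi] := boolP (p %| i).
  by rewrite di; have /dvdnP[j ->] := pi; rewrite mulnC expgM mem_cycle.
case/negP: nKc; rewrite defK.
have : generator <[c]> d.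
  rewrite di generator_coprime.
  by rewrite (pnat_coprime pc) // p'natE.
by move/eqP <-.
Qed.

(** Nilpotency makes [<c>, G] a proper subgroup of <c>, hence part of its maximal subgroup <c^p>. *)
Lemma commg_cycle_expg (c g : gT) :
  c \in G^`(1) -> g \in G -> [~ c, g] \in <[c ^+ p]>.
Proof.
move=> cG' gG.
have sc : <[c]> \subset G^`(1) by rewrite cycle_subG.
have nc := cyclic_der1_sub_normal sc.
have pc : p.-elt c by apply: mem_p_elt (subsetP (der_sub 1 G) _ cG').
have [c1|c1] := eqVneq c 1; first by rewrite c1 comm1g group1.
have pr : [~: <[c]>, G] \proper <[c]>.
  apply: (nil_comm_properl (pgroup_nil pG)) (normal_sub nc) _ _.
    by rewrite cycle_eq1.
  by rewrite subsetI subxx normal_norm.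
apply: (subsetP (@cycle_cycle_expg c [~: <[c]>, G]%G pc pr)).
by rewrite mem_commg // cycle_id.
Qed.

Lemma mem_commg_der1 x y : x \in G -> y \in G -> [~ x, y] \in G^`(1).
Proof. by move=> xG yG; rewrite mem_commg. Qed.

(* Modulo <[c ^+ p]> the commutator c is central of order dividing p, so the
   class-two power formula applies, and p divides 'C(p, 2). *)
Lemma expMg_p (x d : gT) : x \in G -> d \in G ->
  exists2 z, z \in <[[~ d, x] ^+ p]> & (x * d) ^+ p = x ^+ p * d ^+ p * z.
Proof.
move=> xG dG; set c := [~ d, x].
have cG' : c \in G^`(1) by apply: mem_commg_der1.
have sN : <[c ^+ p]> \subset G^`(1) by rewrite cycle_subG groupX.
have nN := normal_norm (cyclic_der1_sub_normal sN).
have xN : x \in 'N(<[c ^+ p]>) := subsetP nN _ xG.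
have dN : d \in 'N(<[c ^+ p]>) := subsetP nN _ dG.
have cN : c \in 'N(<[c ^+ p]>) := subsetP nN _ (subsetP (der_sub 1 G) _ cG').
have ccom g : g \in G -> commute (coset <[c ^+ p]> g) (coset <[c ^+ p]> c).
  move=> gG; have gN := subsetP nN _ gG.
  apply: commute_sym; apply/commgP; rewrite -morphR //.
  by apply/eqP; apply: coset_id; rewrite commg_cycle_expg.
have E : coset <[c ^+ p]> ((x * d) ^+ p) = coset <[c ^+ p]> (x ^+ p * d ^+ p).
  have xdN := groupM xN dN.
  rewrite [LHS]morphX // morphM // expMg_Rmul -?morphR -?/c //; try exact: ccom.
  rewrite [RHS]morphM ?groupX // !morphX //=.
  have /dvdnP[j ->] : p %| 'C(p, 2).
    by rewrite prime_dvd_bin //= odd_prime_gt2.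
  have c1 : coset <[c ^+ p]> c ^+ p = 1.
    by have /= <- := morphX (coset_morphism <[c ^+ p]>) p cN; rewrite coset_id ?cycle_id.
  by rewrite mulnC expgM c1 expg1n mulg1.
have /rcosetP[z zN Ez] : (x * d) ^+ p \in <[c ^+ p]> :* (x ^+ p * d ^+ p).
  by apply/rcoset_kercosetP; rewrite ?groupX ?groupM ?groupX.
exists (z ^ (x ^+ p * d ^+ p)); last by rewrite -conjgC -Ez.
by rewrite memJ_norm // groupM ?groupX.
Qed.

Lemma cycle_expg_gen (c z : gT) : p.-elt c -> z \in <[c ^+ p]> ->
  <[c * z]> = <[c]>.
Proof.
move=> pc /cycleP[j ->]; rewrite -expgM -[X in X * _](expg1 c) -expgD.
apply/eqP; rewrite eq_sym -[_ == _]/(generator _ _) generator_coprime.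
rewrite (pnat_coprime pc) // p'natE // dvdn_addl ?dvdn_mulr //.
by rewrite Euclid_dvd1.
Qed.

(** With c = [d, x], [d^p, x] = d^(-p) (dc)^p = c^p z by [expMg_p]. Here z is a power of [c, d]^p,
    hence lies in <c^(p^2)>, and such a factor does not change the subgroup generated by c^p. *)
Lemma cycle_commXp (d x : gT) : d \in G -> x \in G ->
  <[[~ d ^+ p, x]]> = <[[~ d, x] ^+ p]>.
Proof.
move=> dG xG; set c := [~ d, x].
have cG' : c \in G^`(1) by apply: mem_commg_der1.
have cG := subsetP (der_sub 1 G) _ cG'.
have pc : p.-elt c by apply: mem_p_elt cG.
have [z zc E] := expMg_p dG cG.
have -> : [~ d ^+ p, x] = c ^+ p * z.
  by rewrite commgEl conjXg -[d ^ x](mulKVg d) -commgEl -/c E -!mulgA mulKg.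
apply: cycle_expg_gen; first by rewrite p_eltX.
apply: subsetP zc; rewrite cycle_subG.
have /cycleP[i ->] := commg_cycle_expg cG' dG.
by rewrite expgAC mem_cycle.
Qed.

Lemma cycle_eqX (rT : finGroupType) (x y : rT) n :
  <[x]> = <[y]> -> <[x ^+ n]> = <[y ^+ n]>.
Proof.
suff sub (u v : rT) : <[u]> = <[v]> -> <[u ^+ n]> \subset <[v ^+ n]>.
  by move=> xy; apply/eqP; rewrite eqEsubset !sub.
move=> uv; have /cycleP[i ->] : u \in <[v]> by rewrite -uv cycle_id.
by rewrite cycle_subG expgAC mem_cycle.
Qed.

Lemma cycle_commX (d x : gT) n : d \in G -> x \in G ->
  <[[~ d ^+ (p ^ n), x]]> = <[[~ d, x] ^+ (p ^ n)]>.
Proof.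
move=> dG xG; elim: n => [|n IH]; first by rewrite !expg1.
rewrite expnSr expgM cycle_commXp ?groupX // expgM.
exact: cycle_eqX.
Qed.

Lemma commX_eq1 (d x : gT) n : d \in G -> x \in G ->
  ([~ d ^+ (p ^ n), x] == 1) = (#[[~ d, x]] %| p ^ n).
Proof. by move=> dG xG; rewrite -cycle_eq1 cycle_commX // cycle_eq1 order_dvdn. Qed.

(** Regularity, by induction on n: (xd)^p = x^p d^p z, where z is a power of [d, x]^p. Since
    d^(p^(n+1)) = 1 commutes with x, [d, x] has order dividing p^(n+1), so z^(p^n) = 1. The
    induction hypothesis removes first z from d^p z, then d^p z from the whole product. *)
Lemma expgM_pX_eq (x d : gT) n : x \in G -> d \in G -> d ^+ (p ^ n) = 1 ->
  (x * d) ^+ (p ^ n) = x ^+ (p ^ n).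
Proof.
elim: n x d => [|n IH] x d xG dG d1; first by rewrite expg1 in d1; rewrite d1 mulg1.
have cX : [~ d, x] ^+ (p ^ n.+1) = 1.
  by apply/eqP; rewrite -order_dvdn -commX_eq1 // d1 comm1g.
have [z /cycleP[j zj] E] := expMg_p xG dG.
have z1 : z ^+ (p ^ n) = 1.
  by rewrite zj expgAC -(expgM _ p) -expnS cX expg1n.
have zG : z \in G by rewrite zj !groupX ?groupR.
rewrite expnS !expgM E -mulgA IH ?groupX ?groupM ?groupX //.
by rewrite IH ?groupX // -expgM -expnS.
Qed.

End Regular.

(** * The centralizer of the derived subgroup *)

Lemma dvdn_order_coset (gT : finGroupType) (G N : {group gT}) x n :
  N <| G -> x \in G -> (#[coset N x] %| n) = (x ^+ n \in N).
Proof.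
move=> nN xG; have xN := subsetP (normal_norm nN) _ xG.
rewrite order_dvdn -[_ ^+ n](morphX (coset_morphism N)) //=.
by apply/eqP/idP=> [/coset_idr->|/coset_id//]; rewrite ?groupX.
Qed.

Section PGroup.
Variables (gT : finGroupType) (G : {group gT}) (p : nat).
Hypotheses (pG : p.-group G) (p_pr : prime p).

Lemma order_pX x : x \in G -> exists n, #[x] = (p ^ n)%N.
Proof. by move=> xG; have [n] := p_natP (mem_p_elt pG xG); exists n. Qed.

Lemma card_pX (N : {group gT}) : N \subset G -> exists n, #|N| = (p ^ n)%N.
Proof. by move=> sN; have [n] := p_natP (pgroupS sN pG); exists n. Qed.

Lemma der1_sub_Phi : G^`(1) \subset 'Phi(G).
Proof. by rewrite (Phi_joing pG) joing_subl. Qed.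

Lemma gen2_decomp x y g : G :=: <<[set x; y]>> -> g \in G ->
  exists i j, exists2 z, z \in G^`(1) & g = x ^+ i * y ^+ j * z.
Proof.
move=> defG gG; have [xG yG] : x \in G /\ y \in G.
  by rewrite defG !mem_gen ?set21 ?set22.
have nG' := normal_norm (der_normal 1 G).
have [xN yN] := (subsetP nG' _ xG, subsetP nG' _ yG).
have cxy : commute (coset G^`(1) x) (coset G^`(1) y).
  by apply: (centsP (der_abelian 0 G)); rewrite mem_quotient.
have : coset G^`(1) g \in <[coset G^`(1) x]> * <[coset G^`(1) y]>.
  have -> : <[coset G^`(1) x]> * <[coset G^`(1) y]> = G / G^`(1).
    rewrite -cent_joinEl; last by rewrite cent_cycle cycle_subG; apply/cent1P.
    have -> : G / G^`(1) = <<[set x; y]>> / G^`(1) by rewrite -defG.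
    rewrite quotient_gen; last by rewrite subUset !sub1set xN yN.
    rewrite quotientU !quotient_set1 ?(subsetP nG') //.
    by rewrite joing_idl joing_idr.
  by rewrite mem_quotient.
case/mulsgP=> _ _ /cycleP[i ->] /cycleP[j ->] E; exists i, j.
have : g \in (x ^+ i * y ^+ j) *: G^`(1).
  rewrite -norm_rlcoset ?(subsetP nG') ?groupM ?groupX //.
  apply/rcoset_kercosetP; rewrite ?groupM ?groupX ?(subsetP nG') //.
  by rewrite E morphM ?groupX // !morphX.
by case/lcosetP=> z zG' ->; exists z.
Qed.

(** Burnside's basis theorem: G' lies in the Frattini subgroup, so generators may be tested modulo
    G'. *)
Lemma gen2_quotient x y : x \in G -> y \in G ->
  G / G^`(1) = <[coset G^`(1) x]> * <[coset G^`(1) y]> -> G :=: <<[set x; y]>>.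
Proof.
move=> xG yG defQ; symmetry; apply: Phi_nongen.
have nG' := normal_norm (der_normal 1 G).
apply/eqP; rewrite eqEsubset join_subG Phi_sub subUset !sub1set xG yG /=.
apply/subsetP=> g gG; have := mem_quotient G^`(1) gG.
rewrite defQ => /mulsgP[_ _ /cycleP[i ->] /cycleP[j ->] E].
have : g \in G^`(1) :* (x ^+ i * y ^+ j).
  apply/rcoset_kercosetP; rewrite ?groupM ?groupX ?(subsetP nG') //.
  by rewrite E morphM ?groupX ?(subsetP nG') // !morphX ?(subsetP nG').
case/rcosetP=> z zG' ->; rewrite groupM //.
  by apply: (subsetP (joing_subl _ _)); apply: (subsetP der1_sub_Phi).
have sub := subsetP (joing_subr 'Phi(G) [set x; y]).
by rewrite groupM ?groupX // sub ?set21 ?set22.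
Qed.

Lemma expgM_der1 x y n : x \in G -> y \in G ->
  exists2 z, z \in G^`(1) & (x * y) ^+ n = x ^+ n * y ^+ n * z.
Proof.
move=> xG yG; have nG' := normal_norm (der_normal 1 G).
exists ((x ^+ n * y ^+ n)^-1 * (x * y) ^+ n); last by rewrite mulKVg.
apply: coset_idr; first by rewrite (subsetP nG') ?groupM ?groupV ?groupX ?groupM ?groupX.
have [xN yN] := (subsetP nG' _ xG, subsetP nG' _ yG).
rewrite morphM ?groupV ?groupX ?groupM ?groupX // morphV ?groupM ?groupX //.
rewrite morphX ?groupM // !morphM ?groupX // !morphX //= expgMn ?mulVg //.
by apply: (centsP (der_abelian 0 G)); rewrite mem_quotient.
Qed.

End PGroup.

(** For G' <= N <= G this is the preimage of the n-torsion of the abelian group G/N. The generated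
    subgroup gives a group structure for arbitrary n and N; [mem_relOhm] shows that it adds nothing
    when G' <= N. *)
Definition relOhm (gT : finGroupType) (n : nat) (G N : {set gT}) : {set gT} :=
  <<[set g in G | g ^+ n \in N]>>.
Canonical relOhm_group gT n G N : {group gT} := [group of @relOhm gT n G N].

Section RelOhm.
Variables (gT : finGroupType) (G N : {group gT}).
Hypothesis sG'N : G^`(1) \subset N.

Lemma mem_relOhm n x : (x \in relOhm n G N) = (x \in G) && (x ^+ n \in N).
Proof.
rewrite /relOhm gen_set_id ?inE //; apply/group_setP; split.
  by rewrite inE group1 expg1n group1.
move=> y z; rewrite !inE => /andP[yG yN] /andP[zG zN]; rewrite groupM //=.
have [w wG' ->] := expgM_der1 n yG zG.
by rewrite !groupM // (subsetP sG'N).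
Qed.

Lemma relOhm_sub n : relOhm n G N \subset G.
Proof. by apply/subsetP=> x; rewrite mem_relOhm => /andP[]. Qed.

Lemma relOhm_der1 n : G^`(1) \subset relOhm n G N.
Proof.
apply/subsetP=> x xG'; rewrite mem_relOhm groupX ?(subsetP sG'N) // andbT.
exact: (subsetP (der_sub 1 G)).
Qed.

Lemma relOhm_normal n : relOhm n G N <| G.
Proof. by rewrite sub_der1_normal ?relOhm_sub ?relOhm_der1. Qed.
End RelOhm.

(** * Orders of products, and orders modulo the centralizer of G' *)

Section Orders.
Variables (gT : finGroupType) (G : {group gT}) (p : nat).
Hypotheses (p_odd : odd p) (pG : p.-group G) (p_pr : prime p).
Hypothesis cycG' : cyclic G^`(1).
Local Notation C := 'C_G(G^`(1)).

(** Orders are powers of p, so the maximum m is a common multiple, and regularity gives (xy)^m = x^m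
    once y^m = 1. *)
Lemma order_mulg_max x y : x \in G -> y \in G -> #[x * y] <= maxn #[x] #[y].
Proof.
move=> xG yG.
have [i Di] := order_pX pG xG; have [j Dj] := order_pX pG yG.
have -> : maxn #[x] #[y] = (p ^ maxn i j)%N.
  rewrite Di Dj; case: (leqP i j) => ij; [apply/maxn_idPr | apply/maxn_idPl].
    by rewrite leq_exp2l ?prime_gt1.
  by rewrite leq_exp2l ?prime_gt1 // ltnW.
apply: dvdn_leq; first by rewrite expn_gt0 prime_gt0.
have yM : y ^+ (p ^ maxn i j) = 1.
  by apply/eqP; rewrite -order_dvdn Dj dvdn_exp2l ?leq_maxr.
rewrite order_dvdn (expgM_pX_eq p_odd pG p_pr cycG') // -order_dvdn Di.
by rewrite dvdn_exp2l ?leq_maxl.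
Qed.

(** [order_mulg_max] applied to y = x^-1 (xy). *)
Lemma order_mulg_ge x y : x \in G -> y \in G -> #[x] < #[y] -> #[y] <= #[x * y].
Proof.
move=> xG yG lt; rewrite -{1}(mulKg x y).
have := order_mulg_max (groupVr xG) (groupM xG yG).
by rewrite mulKg orderV leq_max leqNgt lt.
Qed.

Lemma cent_der1_normal : C <| G.
Proof. by rewrite /normal subsetIl normsI ?normG ?norms_cent ?der_norm. Qed.

Lemma der1_sub_cent : G^`(1) \subset C.
Proof. by rewrite subsetI der_sub; apply: cyclic_abelian. Qed.

Lemma mem_cent_der1 a x : G^`(1) = <[a]> -> x \in G -> (x \in C) = ([~ x, a] == 1).
Proof.
move=> Da xG; rewrite in_setI xG Da cent_cycle /=.
by apply/cent1P/commgP => /commute_sym.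
Qed.

(** Both orders are powers of p, and by [commX_eq1] the element y^(p^j) centralizes a exactly when
    the order of [y, a] divides p^j. *)
Lemma order_coset_cent a y : G^`(1) = <[a]> -> y \in G ->
  #[coset C y] = #[[~ a, y]].
Proof.
move=> Da yG; have aG : a \in G by rewrite (subsetP (der_sub 1 G)) // Da cycle_id.
rewrite -invg_comm orderV.
have [n Dn] := order_pX pG (groupR yG aG).
have [l Dl] : exists l, #[coset C y] = (p ^ l)%N.
  by apply: (order_pX (quotient_pgroup 'C_G(G^`(1)) pG)); apply: mem_quotient.
have E j : (n <= j) = (l <= j).
  rewrite -(dvdn_Pexp2l _ _ (prime_gt1 p_pr)) -(@dvdn_Pexp2l p l) ?prime_gt1 //.
  rewrite -Dl (dvdn_order_coset _ cent_der1_normal) // (mem_cent_der1 Da) ?groupX //.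
  by rewrite (commX_eq1 p_odd pG p_pr cycG') ?Dn.
by rewrite Dn Dl; congr (_ ^ _)%N; apply/eqP; rewrite eqn_leq -E leqnn E leqnn.
Qed.

(* Conjugation by y moves a generator a of G' through all of a<[a, y]>. *)
Lemma mulX_cent x y : x \in G -> y \in G -> #[coset C x] %| #[coset C y] ->
  exists j, x * y ^+ j \in C.
Proof.
move=> xG yG; have /cyclicP[a Da] := cycG'.
rewrite !(order_coset_cent Da) // => dvxy.
have aG : a \in G by rewrite (subsetP (der_sub 1 G)) // Da cycle_id.
set o := #[[~ a, y]] in dvxy *.
have sub z : z \in G -> [~ a, z] \in <[a]> by move=> zG; rewrite -Da mem_commg.
have axy : [~ a, x] \in <[[~ a, y]]>.
  have sx : <[[~ a, x]]> \subset <[a]> by rewrite cycle_subG sub.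
  have sy : <[[~ a, y]]> \subset <[a]> by rewrite cycle_subG sub.
  by rewrite -cycle_subG -(cardSg_cyclic (cycle_cyclic a) sx sy).
set A := [set a ^ (y ^+ val i) | i : 'I_o].
have nN : <[[~ a, y]]> <| G.
  by rewrite (cyclic_der1_sub_normal cycG') // Da cycle_subG sub.
have ynC n : (a ^ (y ^+ n) == a) = (o %| n).
  rewrite /o -(order_coset_cent Da yG) (dvdn_order_coset _ cent_der1_normal) //.
  by rewrite (mem_cent_der1 Da) ?groupX // conjg_fix commg1_sym.
have AK : A \subset a *: <[[~ a, y]]>.
  apply/subsetP=> _ /imsetP[[i _] _ ->] /=; elim: i => [|i IH].
    by rewrite conjg1 lcoset_refl.
  rewrite expgSr conjgM; have /lcosetP[k kK ->] := IH.
  rewrite conjMg -{1}(mulKVg a (a ^ y)) -commgEl -mulgA.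
  by rewrite mem_lcoset mulKg groupM ?cycle_id // memJ_norm // (subsetP (normal_norm nN)).
have cardA : #|A| = o.
  rewrite card_imset ?card_ord // => i l; wlog il : i l / i <= l.
    by move=> W; case: (leqP i l) => [|/ltnW] /W // H E; rewrite H.
  move=> E; apply/val_inj/eqP; rewrite eqn_leq il /= leqNgt; apply/negP=> lt.
  have : o %| l - i.
    rewrite -ynC -(inj_eq (conjg_inj (y ^+ i))) -conjgM -expgD subnK //.
    exact/eqP.
  by rewrite gtnNdvd ?subn_gt0 // (leq_ltn_trans (leq_subr _ _)).
have : a ^ x \in A.
  have /eqP -> : A == a *: <[[~ a, y]]> by rewrite eqEcard AK card_lcoset cardA /=.
  by rewrite mem_lcoset -commgEl.
case/imsetP=> [[i _] _] /= E.
have /cycleP[j Dj] : y ^- i \in <[y]> by rewrite groupV mem_cycle.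
exists j; rewrite -Dj (mem_cent_der1 Da) ?groupM ?groupV ?groupX //.
by rewrite commg1_sym -conjg_fix conjgM E conjgK.
Qed.
End Orders.

(** * Groups generated by b and u with u centralizing G' *)

Section Split.
Variables (gT : finGroupType) (G : {group gT}) (p : nat).
Hypotheses (p_odd : odd p) (pG : p.-group G) (p_pr : prime p).
Hypothesis cycG' : cyclic G^`(1).
Variables (b u : gT).
Hypotheses (defG : G :=: <<[set b; u]>>) (uC : u \in 'C_G(G^`(1))).
Let a := [~ u, b].
Let C := 'C_G(G^`(1))%G.

Let bG : b \in G. Proof. by rewrite defG mem_gen ?set21. Qed.
Let uG : u \in G. Proof. by case/setIP: uC. Qed.
Let ucent : {in G^`(1), forall z, commute u z}.
Proof. by case/setIP: uC => _ /centP. Qed.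
Let aG' : a \in G^`(1). Proof. by rewrite mem_commg. Qed.

(** Modulo <a>, which is normal as a subgroup of the cyclic group G', the generators b and u
    commute. *)
Lemma split_der1 : G^`(1) = <[a]>.
Proof.
have sa : <[a]> \subset G^`(1) by rewrite cycle_subG.
have nN := normal_norm (cyclic_der1_sub_normal cycG' sa).
apply/eqP; rewrite eqEsubset sa andbT.
apply: der1_min => //.
have -> : G / <[a]> = <<[set b; u]>> / <[a]> by rewrite -defG.
rewrite quotient_gen; last first.
  by rewrite subUset !sub1set !(subsetP nN).
rewrite abelian_gen quotientU !quotient_set1 ?(subsetP nN) //.
have cub : commute (coset <[a]> u) (coset <[a]> b).
  apply/commgP; rewrite -morphR ?(subsetP nN) //=.
  by rewrite coset_id // cycle_id.
by apply/centsP=> x /set2P[]-> y /set2P[]-> //; apply: commute_sym.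
Qed.

Let orda : #[a] = #|G^`(1)|. Proof. by rewrite split_der1. Qed.

Let ord_bu : #[[~ b, u]] = #|G^`(1)|.
Proof. by rewrite -invg_comm orderV. Qed.

(** [commX_eq1] handles exponents that are powers of p. A nonzero i reduces to its p-part p^l, since
    b^i and b^(p^l) generate the same subgroup. *)
Lemma split_commute_gen i : ([~ b ^+ i, u] == 1) = (#|G^`(1)| %| i).
Proof.
have [n Dn] := card_pX pG (der_sub 1 G).
have [->|i0] := eqVneq i 0; first by rewrite expg0 comm1g eqxx dvdn0.
have ipos : 0 < i by rewrite lt0n.
have [n0 n0i defi] := pfactor_coprime p_pr ipos.
set l := logn p i in defi.
have eqc : <[b ^+ i]> = <[b ^+ (p ^ l)]>.
  rewrite defi mulnC expgM; apply/eqP; rewrite eq_sym.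
  rewrite -[_ == _]/(generator _ _) generator_coprime.
  have := mem_p_elt pG bG => pb.
  by apply: (@pnat_coprime p); [apply: p_eltX | rewrite p'natE // -prime_coprime].
have -> : ([~ b ^+ i, u] == 1) = ([~ b ^+ (p ^ l), u] == 1).
  have key g : ([~ g, u] == 1) = (<[g]> \subset 'C[u]).
    by rewrite cycle_subG; apply/commgP/cent1P.
  by rewrite !key eqc.
rewrite (commX_eq1 p_odd pG p_pr cycG') // ord_bu Dn.
rewrite !dvdn_Pexp2l ?prime_gt1 //.
by rewrite pfactor_dvdn.
Qed.

Let nC : C <| G := cent_der1_normal G.
Let G'C : G^`(1) \subset C := der1_sub_cent cycG'.

Lemma split_coset_gen : G / C = <[coset C b]>.
Proof.
have nN := normal_norm nC.
apply/eqP; rewrite eqEsubset cycle_subG mem_quotient // andbT.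
apply/subsetP=> _ /morphimP[g gN gG ->] /=.
have [i [j [z zG' ->]]] := gen2_decomp defG gG.
have uzC : u ^+ j * z \in C by rewrite groupM ?groupX // (subsetP G'C).
rewrite -mulgA morphM ?groupX ?(subsetP nN) ?(subsetP (normal_sub nC) _ uzC) //=.
by rewrite (coset_id uzC) mulg1 morphX ?mem_cycle ?(subsetP nN).
Qed.

Lemma split_mem_C i : (b ^+ i \in C) = (#|G : C| %| i).
Proof.
rewrite -card_quotient ?normal_norm // split_coset_gen -orderE.
by rewrite (dvdn_order_coset _ nC).
Qed.

Lemma split_order_comm : #[[~ a, b]] = #|G : C|.
Proof.
rewrite -(order_coset_cent p_odd pG p_pr cycG' split_der1 bG).
by rewrite -card_quotient ?normal_norm // split_coset_gen.
Qed.

Lemma split_index_dvd : #|G : C| %| #|G^`(1)|.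
Proof.
rewrite -split_order_comm order_dvdG // mem_commg //.
exact: (subsetP (der_sub 1 G)).
Qed.

(** The commutators [z, b] with z in G' = <a> are the powers of [a, b], which has order |G:C|; they
    form the subgroup <a^q>. *)
Let q := (#|G^`(1)| %/ #|G : C|)%N.

Lemma split_comm_z : <[[~ a, b]]> = <[a ^+ q]>.
Proof.
have ab : [~ a, b] \in <[a]>.
  by rewrite -split_der1 mem_commg // (subsetP (der_sub 1 G)).
apply/eqP; rewrite (eq_subG_cyclic (cycle_cyclic a)) ?cycle_subG ?mem_cycle //.
rewrite -!orderE split_order_comm orderXdiv orda ?dvdn_div //.
  by rewrite /q divnA ?split_index_dvd // mulKn.
exact: split_index_dvd.
Qed.

Let aG : a \in G. Proof. exact: (subsetP (der_sub 1 G) _ aG'). Qed.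

Let comm_aX l : [~ a ^+ l, b] = [~ a, b] ^+ l.
Proof.
apply: commXg; apply: (centsP (cyclic_abelian cycG')) => //.
by rewrite mem_commg.
Qed.

Let commzb z : z \in G^`(1) -> [~ z, b] \in <[a ^+ q]>.
Proof.
rewrite split_der1 => /cycleP[l ->]; rewrite -split_comm_z comm_aX.
exact: mem_cycle.
Qed.

Let commzb_surj w : w \in <[a ^+ q]> -> exists2 z, z \in G^`(1) & [~ z, b] = w.
Proof.
rewrite -split_comm_z => /cycleP[l ->]; exists (a ^+ l); last exact: comm_aX.
exact: groupX.
Qed.

Let comm_uX j : [~ u ^+ j, b] = a ^+ j.
Proof. by apply: commXg; apply: ucent. Qed.

Let comm_uwX j w : w \in G^`(1) -> [~ u ^+ j * w, b] = a ^+ j * [~ w, b].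
Proof.
move=> wG'; rewrite commMgJ comm_uX conjgE.
have -> : a ^+ j * w = w * a ^+ j.
  by apply: (centsP (cyclic_abelian cycG')); rewrite ?groupX.
by rewrite mulKg.
Qed.

Let q_dvd : q %| #|G^`(1)|.
Proof. by rewrite dvdn_div ?split_index_dvd. Qed.

Let N := ('Z(G) <*> G^`(1))%G.

Let memN x : (x \in N) -> exists2 z, z \in G^`(1) & x * z \in 'Z(G).
Proof.
rewrite /= cent_joinEl; last first.
  by rewrite (subset_trans (subsetIr _ _)) // centS ?der_sub.
case/mulsgP=> c z cZ zG' ->; exists z^-1; rewrite ?groupV //.
by rewrite mulgK.
Qed.

Let mem_center x : x \in G -> commute x b -> commute x u -> x \in 'Z(G).
Proof.
move=> xG xb xu; apply/setIP; split=> //; rewrite -sub_cent1 defG gen_subG.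
by rewrite subUset !sub1set; apply/andP; split; apply/cent1P; apply: commute_sym.
Qed.

(** Membership in N means being central after a correction by some element of G'. Commuting with u
    forces |G'| to divide i, and then b^i is itself central. What remains is u^j w with w in G', and
    [u^j w, b] = a^j [w, b] can be made trivial exactly when a^j lies in <a^q>. *)
Lemma split_mem_center i j z : z \in G^`(1) ->
  (b ^+ i * u ^+ j * z \in N) = (#|G^`(1)| %| i) && (q %| j).
Proof.
move=> zG'; have zG := subsetP (der_sub 1 G) _ zG'.
apply/idP/andP=> [|[Mi qj]]; last first.
  have bZ : b ^+ i \in 'Z(G).
    apply: mem_center; rewrite ?groupX //; first exact/commute_sym/commuteX.
    by apply/commgP; rewrite split_commute_gen.
  have uN : u ^+ j \in N.
    have [w wG' Ew] : exists2 w, w \in G^`(1) & [~ w, b] = a ^- j.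
      apply: commzb_surj; rewrite groupV; case/dvdnP: qj => l ->.
      by rewrite mulnC expgM mem_cycle.
    have wG := subsetP (der_sub 1 G) _ wG'.
    have uwZ : u ^+ j * w \in 'Z(G).
      apply: mem_center; rewrite ?groupM ?groupX //.
        by apply/commgP; rewrite comm_uwX // Ew mulgV.
      apply: commute_sym; apply: commuteM; first exact: commuteX.
      exact: ucent.
    rewrite -[u ^+ j](mulgK w) groupM // ?groupV.
      by apply: (subsetP (joing_subl _ _)).
    by apply: (subsetP (joing_subr _ _)).
  rewrite !groupM //; first by apply: (subsetP (joing_subl _ _)).
  by apply: (subsetP (joing_subr _ _)).
case/memN=> z' z'G' cZ; set w := z * z'.
have wG' : w \in G^`(1) by rewrite groupM.
have wG := subsetP (der_sub 1 G) _ wG'.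
have {}cZ : b ^+ i * (u ^+ j * w) \in 'Z(G) by rewrite /w !mulgA -[_ * z * z']mulgA mulgA.
have uwu : commute (u ^+ j * w) u.
  by apply: commute_sym; apply: commuteM; [exact: commuteX | exact: ucent].
have cu : commute (b ^+ i * (u ^+ j * w)) u by case/setIP: cZ => _ /centP; apply.
have Mi : #|G^`(1)| %| i.
  rewrite -split_commute_gen; apply/commgP.
  rewrite -[b ^+ i](mulgK (u ^+ j * w)); apply: commute_sym; apply: commuteM.
    exact: commute_sym.
  by apply: commuteV; apply: commute_sym.
split=> //.
have bZ : b ^+ i \in 'Z(G).
  apply: mem_center; rewrite ?groupX //; first exact/commute_sym/commuteX.
  by apply/commgP; rewrite split_commute_gen.
have : u ^+ j * w \in 'Z(G) by rewrite -(groupMl _ bZ).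
case/setIP=> _ /centP/(_ b bG)/commgP; rewrite comm_uwX // => /eqP E.
have : a ^+ j \in <[a ^+ q]>.
  by rewrite -[a ^+ j](mulgK [~ w, b]) E mul1g groupV commzb.
case/cycleP=> l; rewrite -expgM => /eqP.
rewrite eq_expg_mod_order orda => /eqP E2.
by rewrite /dvdn -(modn_dvdm j q_dvd) E2 (modn_dvdm _ q_dvd) modnMr.
Qed.

Let nN : N <| G.
Proof. by rewrite /= normalY ?center_normal ?der_normal. Qed.

Let G'N : G^`(1) \subset N. Proof. exact: joing_subr. Qed.

Let M_gt0 : 0 < #|G^`(1)|. Proof. exact: cardG_gt0. Qed.
Let q_gt0 : 0 < q. Proof. exact: dvdn_gt0 M_gt0 q_dvd. Qed.

(** Modulo G', x = b^i u^j has x^q = b^(iq) u^(jq), and q divides jq. So x^q lies in N iff |G'| =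
    |G:C| q divides iq, that is iff b^i lies in C. *)
Lemma split_cent_root x : x \in G -> (x \in C) = (x ^+ q \in N).
Proof.
move=> xG; have [i [j [z zG' ->]]] := gen2_decomp defG xG.
have zG := subsetP (der_sub 1 G) _ zG'.
rewrite (groupMr _ (subsetP G'C _ zG')) (groupMr _ (groupX j uC)) split_mem_C.
have [w wG' ->] := expgM_der1 q (groupM (groupX i bG) (groupX j uG)) zG.
have [v vG' ->] := expgM_der1 q (groupX i bG) (groupX j uG).
rewrite -!mulgA mulgA -!expgM.
rewrite split_mem_center ?groupM //; last exact: groupX.
rewrite (dvdn_mull j (dvdnn q)) andbT.
have -> : #|G^`(1)| = (#|G : C| * q)%N.
  by rewrite /q mulnC divnK ?split_index_dvd.
by rewrite dvdn_pmul2r.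
Qed.

(** By [split_mem_center], G/N is the direct product of <bN>, of order |G'|, and <uN>, of order
    q. *)
Lemma split_center_index : #|G : N| = (#|G^`(1)| * q)%N.
Proof.
have nNG := normal_norm nN.
have bE i : (coset N b ^+ i == 1) = (#|G^`(1)| %| i).
  rewrite -order_dvdn (dvdn_order_coset _ nN) //.
  by rewrite -(mulg1 (b ^+ i)) -(expg0 u) -(mulg1 (_ * _)) split_mem_center ?dvdn0 ?andbT.
have uE j : (coset N u ^+ j == 1) = (q %| j).
  rewrite -order_dvdn (dvdn_order_coset _ nN) //.
  by rewrite -(mul1g (u ^+ j)) -(expg0 b) -(mulg1 (_ * _)) split_mem_center ?dvdn0.
have ob : #[coset N b] = #|G^`(1)|.
  by apply/eqP; rewrite eqn_dvd order_dvdn bE dvdnn -bE -order_dvdn dvdnn.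
have ou : #[coset N u] = q.
  by apply/eqP; rewrite eqn_dvd order_dvdn uE dvdnn -uE -order_dvdn dvdnn.
rewrite -card_quotient // -ob -ou !orderE -TI_cardMg; last first.
  apply/trivgP/subsetP=> _ /setIP[/cycleP[i ->] /cycleP[j]] E.
  rewrite inE bE; have : b ^+ i * (u ^+ j)^-1 \in N.
    apply: coset_idr; first by rewrite groupM ?groupV ?groupX ?(subsetP nNG).
    rewrite morphM ?groupV ?groupX ?(subsetP nNG) // morphV ?groupX ?(subsetP nNG) //.
    by rewrite !morphX ?(subsetP nNG) //= E mulgV.
  have /cycleP[l ->] : (u ^+ j)^-1 \in <[u]> by rewrite groupV mem_cycle.
  by rewrite -[_ * _]mulg1 split_mem_center // => /andP[].
congr #|pred_of_set _|; apply/eqP; rewrite eqEsubset mul_subG ?cycle_subG ?mem_quotient //.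
rewrite andbT; apply/subsetP=> _ /morphimP[g gN gG ->] /=.
have [i [j [z zG' ->]]] := gen2_decomp defG gG.
have zN := subsetP G'N _ zG'.
rewrite !morphM ?groupM ?groupX ?(subsetP nNG) ?(subsetP (normal_sub nN) _ zN) //=.
rewrite (coset_id zN) mulg1 !morphX ?(subsetP nNG) //.
by rewrite mem_mulg ?mem_cycle.
Qed.

End Split.

(** * Minimal bases *)

Section Basis.
Variables (gT : finGroupType) (G : {group gT}) (p : nat).
Hypotheses (pG : p.-group G) (p_pr : prime p).
Implicit Types b : gT * gT.

Lemma basisP b : is_basis G b ->
  [/\ b.1 \in G, b.2 \in G, G / G^`(1) = <[coset G^`(1) b.1]> * <[coset G^`(1) b.2]>,
      #|G : G^`(1)| = (#[coset G^`(1) b.1] * #[coset G^`(1) b.2])%N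
    & #[coset G^`(1) b.2] %| #[coset G^`(1) b.1]].
Proof.
case/and4P=> b1G b2G /eqP defQ dv; split=> //; first by rewrite (dprodW defQ).
by rewrite -card_quotient ?der_norm // -(dprod_card defQ).
Qed.

Lemma basis_gen b : is_basis G b -> G :=: <<[set b.1; b.2]>>.
Proof. by case/basisP=> b1G b2G defQ _ _; exact: (gen2_quotient pG b1G b2G defQ). Qed.

Lemma basis_exponent b : is_basis G b ->
  exponent (G / G^`(1)) = #[coset G^`(1) b.1].
Proof.
move=> bb; have [b1G b2G defQ _ dv] := basisP bb.
apply/eqP; rewrite eqn_dvd dvdn_exponent ?mem_quotient // andbT.
apply/exponentP=> x; rewrite defQ => /mulsgP[_ _ /cycleP[i ->] /cycleP[j ->] ->].
rewrite expgMn; last first.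
  by apply: (centsP (der_abelian 0 G)); rewrite groupX ?mem_quotient.
rewrite !(expgAC _ _ #[_]) expg_order expg1n mul1g.
by have /dvdnP[l ->] := dv; rewrite mulnC expgM expg_order !expg1n.
Qed.

(** The orders of c1 and c2 modulo G' divide those of b1 and b2, while |A||B| = |AB||A :&: B| keeps
    their product at least |G/G'|. Hence the orders agree and the two cyclic groups meet
    trivially. *)
Lemma is_basis_crit b c1 c2 : is_basis G b -> c1 \in G -> c2 \in G ->
  b.1 \in <<[set c1; c2]>> <*> G^`(1) -> b.2 \in <<[set c1; c2]>> <*> G^`(1) ->
  c1 ^+ #[coset G^`(1) b.1] \in G^`(1) -> c2 ^+ #[coset G^`(1) b.2] \in G^`(1) ->
  is_basis G (c1, c2).
Proof.
move=> bb c1G c2G b1c b2c c1X c2X.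
have [b1G b2G _ cardQ dv] := basisP bb.
have nG' := der_norm 1 G; have nN := der_normal 1 G.
have sG : G \subset <<[set c1; c2]>> <*> G^`(1).
  by rewrite {1}(basis_gen bb) gen_subG subUset !sub1set b1c b2c.
have cc : commute (coset G^`(1) c1) (coset G^`(1) c2).
  by apply: (centsP (der_abelian 0 G)); rewrite mem_quotient.
have defQ : <[coset G^`(1) c1]> * <[coset G^`(1) c2]> = G / G^`(1).
  rewrite -cent_joinEl; last by rewrite cent_cycle cycle_subG; apply/cent1P.
  have -> : G / G^`(1) = <<[set c1; c2]>> / G^`(1).
    apply/eqP; rewrite eqEsubset; apply/andP; split.
      apply: subset_trans (quotientS _ sG) _.
      rewrite joingC quotientYidl // gen_subG subUset !sub1set.
      by rewrite !(subsetP nG').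
    by rewrite quotientS // gen_subG subUset !sub1set c1G c2G.
  rewrite quotient_gen; last by rewrite subUset !sub1set !(subsetP nG').
  rewrite quotientU !quotient_set1 ?(subsetP nG') //.
  by rewrite joing_idl joing_idr.
have d1 : #[coset G^`(1) c1] %| #[coset G^`(1) b.1] by rewrite (dvdn_order_coset _ nN).
have d2 : #[coset G^`(1) c2] %| #[coset G^`(1) b.2] by rewrite (dvdn_order_coset _ nN).
have l1 := dvdn_leq (order_gt0 _) d1; have l2 := dvdn_leq (order_gt0 _) d2.
have := mul_cardG <[coset G^`(1) c1]> <[coset G^`(1) c2]>.
rewrite defQ card_quotient // cardQ -!orderE => E.
set I := #|_ :&: _| in E.
have I_gt0 : 0 < I by apply: cardG_gt0.
have N1_gt0 := order_gt0 (coset G^`(1) b.1).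
have N2_gt0 := order_gt0 (coset G^`(1) b.2).
have k_le := leq_mul l1 l2.
have I1 : I = 1%N.
  apply/eqP; rewrite eqn_leq I_gt0 andbT.
  have NN : 0 < #[coset G^`(1) b.1] * #[coset G^`(1) b.2] by rewrite muln_gt0 N1_gt0.
  by rewrite -(leq_pmul2l NN) -E muln1.
have {}E : (#[coset G^`(1) c1] * #[coset G^`(1) c2])%N
    = (#[coset G^`(1) b.1] * #[coset G^`(1) b.2])%N by rewrite E I1 muln1.
have e1 : #[coset G^`(1) c1] = #[coset G^`(1) b.1].
  apply/eqP; rewrite eqn_leq l1 -(leq_pmul2r N2_gt0) -E leq_pmul2l ?order_gt0 //.
have e2 : #[coset G^`(1) c2] = #[coset G^`(1) b.2].
  by apply/eqP; rewrite -(eqn_pmul2l N1_gt0) -E e1.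
rewrite /is_basis /= c1G c2G e1 e2 dv andbT /=.
rewrite dprodE ?defQ //; first by rewrite cent_cycle cycle_subG; apply/cent1P.
by apply/eqP; rewrite trivg_card_le1 -/I I1.
Qed.

End Basis.

Section Min.
Variables (gT : finGroupType) (G : {group gT}).
Implicit Types b c : gT * gT.
Local Notation C := 'C_G(G^`(1)).

Definition min_basis b := is_basis G b /\
  forall c, is_basis G c -> lexle (basis_tuple G b) (basis_tuple G c).

Lemma lexle_tuple b c : lexle (basis_tuple G b) (basis_tuple G c) =
  (#[coset C b.1] < #[coset C c.1]) || (#[coset C b.1] == #[coset C c.1]) &&
  ((#[coset C b.2] < #[coset C c.2]) || (#[coset C b.2] == #[coset C c.2]) &&
   ((#[c.1] < #[b.1]) || (#[b.1] == #[c.1]) && (#[c.2] <= #[b.2]))).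
Proof.
rewrite /lexle /basis_tuple /= !Num.Theory.ltrN2 Num.Theory.lerN2.
by rewrite !ltz_nat lez_nat !eqz_nat GRing.eqr_opp eqz_nat.
Qed.

(** The premise [c.1 = b.1] of the last bound stands in for equality of the third entries: it serves
    exchanges that keep the first basis element. *)
Lemma min_basis_le b c : min_basis b -> is_basis G c ->
  [/\ #[coset C b.1] <= #[coset C c.1],
      #[coset C c.1] <= #[coset C b.1] -> #[coset C b.2] <= #[coset C c.2],
      #[coset C c.1] <= #[coset C b.1] -> #[coset C c.2] <= #[coset C b.2] ->
        #[c.1] <= #[b.1]
    & #[coset C c.1] <= #[coset C b.1] -> #[coset C c.2] <= #[coset C b.2] ->
        c.1 = b.1 -> #[c.2] <= #[b.2]].
Proof.
case=> _ /(_ c) W /W; rewrite lexle_tuple => H.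
split=> [|le1|le1 le2|le1 le2 e]; move: H.
- by case/orP=> [/ltnW//|/andP[/eqP->]].
- by rewrite ltnNge le1 /= => /andP[_ /orP[/ltnW//|/andP[/eqP->]]].
- rewrite ltnNge le1 /= => /andP[_]; rewrite ltnNge le2 /= => /andP[_].
  by case/orP=> [/ltnW//|/andP[/eqP->]].
- rewrite ltnNge le1 /= => /andP[_]; rewrite ltnNge le2 /= => /andP[_].
  by rewrite e ltnn eqxx.
Qed.

Lemma lexle_total : total lexle.
Proof. move=> [[[a1 a2] a3] a4] [[[b1 b2] b3] b4]; rewrite /lexle /=; lia. Qed.

Lemma lexle_trans : transitive lexle.
Proof.
have step (x y z : int) (P Q R : bool) : (P -> Q -> R) ->
    (x < y)%R || (x == y) && P -> (y < z)%R || (y == z) && Q ->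
    (x < z)%R || (x == z) && R by lia.
move=> [[[b1 b2] b3] b4] [[[a1 a2] a3] a4] [[[c1 c2] c3] c4].
by do 3![apply: (step)]; apply: Order.POrderTheory.le_trans.
Qed.

Lemma seq_min (S : seq (int * int * int * int)) : S != [::] ->
  exists2 t, t \in S & all (lexle t) S.
Proof.
have refl t : lexle t t by have := lexle_total t t; rewrite orbb.
elim: S => // s S IH _; have [->|/IH[t tS tmin]] := eqVneq S [::].
  by exists s; rewrite ?mem_head //= refl.
have [st|ts] := orP (lexle_total s t).
  exists s; rewrite ?mem_head //= refl; apply/allP=> r rS.
  exact: lexle_trans st (allP tmin _ rS).
by exists t; rewrite ?inE ?tS ?orbT //= ts.
Qed.

Lemma Oinv_min : (exists b, is_basis G b) ->
  exists2 b, min_basis b & Oinv G = Some (basis_tuple G b).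
Proof.
case=> b0 bb0; rewrite /Oinv; set S := [seq _ | _ <- _].
have memS b : is_basis G b -> basis_tuple G b \in S.
  by move=> bb; apply: map_f; rewrite mem_enum inE.
have [|t tS tmin] := @seq_min S; first by apply: contraTneq (memS _ bb0) => ->.
have : t \in [seq t0 <- S | all (lexle t0) S] by rewrite mem_filter tmin.
case E : [seq t0 <- S | all (lexle t0) S] => [|r s] // _.
have : r \in [seq t0 <- S | all (lexle t0) S] by rewrite E mem_head.
rewrite mem_filter => /andP[rmin /mapP[b]].
rewrite mem_enum inE => bb defr; exists b; last by rewrite /= defr.
by split=> // c bc; rewrite -defr; apply: (allP rmin); apply: memS.
Qed.

End Min.

(* With o = |G:C|, w = |DC:C|, d = N_1/N_2 and eG, eC, eD the exponents of G, C
   and D, the three cases are o_1 = 1, then o_2 = 1 < o_1, then 1 < o_2 < o_1;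
   o3 is the order of the coset of b1^d. *)
Definition Oform (o w d eG eC eD : nat) : int * int * int * int :=
  if w == o then (Posz 1, Posz o, - Posz eC, - Posz eD)%R else
  let o3 := o %/ gcdn o d in
  if w == o3 then (Posz o, Posz 1, - Posz eG, - Posz (if o3 == 1%N then eD else eC))%R
  else (Posz o, Posz w, - Posz eG, - Posz eD)%R.

(** * The tuple of a minimal basis in terms of G, C and D *)

Section MinForm.
Variables (gT : finGroupType) (G : {group gT}) (p : nat).
Hypotheses (p_odd : odd p) (pG : p.-group G) (p_pr : prime p).
Hypothesis cycG' : cyclic G^`(1).
Variables (b1 b2 : gT).
Hypothesis min_b : min_basis G (b1, b2).

Let C := 'C_G(G^`(1))%G.
Let N1 := #[coset G^`(1) b1].
Let N2 := #[coset G^`(1) b2].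
Let o x := #[coset C x].
Let d := (N1 %/ N2)%N.
Let D := [group of relOhm N2 G G^`(1)].

Let bb : is_basis G (b1, b2). Proof. by case: min_b. Qed.
Let b1G : b1 \in G. Proof. by case: (basisP bb). Qed.
Let b2G : b2 \in G. Proof. by case: (basisP bb). Qed.
Let N21 : N2 %| N1. Proof. by case: (basisP bb). Qed.
Let defG : G :=: <<[set b1; b2]>>. Proof. exact: (basis_gen pG bb). Qed.
Let nG' : G^`(1) <| G. Proof. exact: der_normal. Qed.
Let nC : C <| G. Proof. exact: cent_der1_normal. Qed.
Let G'C : G^`(1) \subset C. Proof. exact: der1_sub_cent. Qed.
Let N12 : N1 = (d * N2)%N. Proof. by rewrite divnK. Qed.
Let N2_gt0 : 0 < N2. Proof. exact: order_gt0. Qed.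

Let subG' z : z \in G^`(1) -> z \in G. Proof. exact: (subsetP (der_sub 1 G)). Qed.

Let relG' n z : z \in G^`(1) -> z \in relOhm n G G^`(1).
Proof. exact: (subsetP (relOhm_der1 (subxx _) _)). Qed.

Let memO n x : x \in G -> (x \in relOhm n G G^`(1)) = (#[coset G^`(1) x] %| n).
Proof. by move=> xG; rewrite mem_relOhm // xG (dvdn_order_coset _ nG'). Qed.

Let memOC n x : x \in G -> (x \in relOhm n G C) = (o x %| n).
Proof. by move=> xG; rewrite (mem_relOhm G'C) xG /o (dvdn_order_coset _ nC). Qed.

Let o1E x : x \in G -> (o x == 1%N) = (x \in C).
Proof. by move=> xG; rewrite -dvdn1 /o (dvdn_order_coset _ nC) // expg1. Qed.

Let pX x : x \in G -> exists n, o x = (p ^ n)%N.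
Proof.
move=> xG; apply: (order_pX (quotient_pgroup C pG)).
exact: mem_quotient.
Qed.

Let o_dvd x y : x \in G -> y \in G -> (o x %| o y) || (o y %| o x) && (o y < o x).
Proof.
move=> /pX[i ->] /pX[j ->]; have p1 := prime_gt1 p_pr.
by rewrite !dvdn_Pexp2l // ltn_exp2l //; case: leqP => // ji; rewrite ltnW.
Qed.

Let b2D : b2 \in D. Proof. by rewrite memO. Qed.

(** Since N2 divides N1, b1 may absorb any power of b2; [basis2] lets b2 absorb b1^i only when b1^i
    lies in D, that is when d divides i. *)
Let basis1 j z : z \in G^`(1) -> is_basis G (b1 * (b2 ^+ j * z), b2).
Proof.
move=> zG'; have zG := subG' zG'.
have cG : b2 ^+ j * z \in G by rewrite groupM ?groupX.
apply: (is_basis_crit pG bb) => //=; first by rewrite groupM.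
- set K := _ <*> _; rewrite -[b1](mulgK (b2 ^+ j * z)).
  have sub := subsetP (joing_subl <<[set b1 * (b2 ^+ j * z); b2]>> G^`(1)).
  rewrite groupM //; first by rewrite sub ?mem_gen ?set21.
  rewrite groupV groupM //; first by rewrite groupX // sub ?mem_gen ?set22.
  exact: (subsetP (joing_subr _ _)).
- by apply: (subsetP (joing_subl _ _)); rewrite mem_gen ?set22.
- have : b1 * (b2 ^+ j * z) \in relOhm N1 G G^`(1).
    by rewrite !groupM ?(relG' _ zG') // ?groupX // memO.
  by rewrite mem_relOhm // => /andP[].
- by rewrite -(dvdn_order_coset _ nG').
Qed.

Let basis2 i z : b1 ^+ i \in D -> z \in G^`(1) ->
  is_basis G (b1, b2 * (b1 ^+ i * z)).
Proof.
move=> iD zG'; have zG := subG' zG'.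
have cG : b1 ^+ i * z \in G by rewrite groupM ?groupX.
apply: (is_basis_crit pG bb) => //=; first by rewrite groupM.
- by apply: (subsetP (joing_subl _ _)); rewrite mem_gen ?set21.
- set K := _ <*> _; rewrite -[b2](mulgK (b1 ^+ i * z)).
  have sub := subsetP (joing_subl <<[set b1; b2 * (b1 ^+ i * z)]>> G^`(1)).
  rewrite groupM //; first by rewrite sub ?mem_gen ?set22.
  rewrite groupV groupM //; first by rewrite groupX // sub ?mem_gen ?set21.
  exact: (subsetP (joing_subr _ _)).
- by rewrite -(dvdn_order_coset _ nG').
- have : b2 * (b1 ^+ i * z) \in D.
    by rewrite !groupM // relG'.
  by rewrite mem_relOhm // => /andP[].
Qed.

Let basis_swap : N1 = N2 -> is_basis G (b2, b1).
Proof.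
move=> e; apply: (is_basis_crit pG bb) => //=.
- by apply: (subsetP (joing_subl _ _)); rewrite mem_gen ?set22.
- by apply: (subsetP (joing_subl _ _)); rewrite mem_gen ?set21.
- by rewrite -(dvdn_order_coset _ nG') // -/N1 e.
- by rewrite -(dvdn_order_coset _ nG') // -/N2 -e.
Qed.

(** Suppose |g| > |b1| and write g = b1^i c. Then |c| >= |g| > |b1|, so the exchanged element b1 c
    has order at least |c|. The elements whose power of exponent o b1 lies in C form a group
    containing b1 and g, hence b1 c, so the first two entries do not grow and minimality is
    contradicted. *)
Let le_b1 g : g \in G -> o g %| o b1 -> #[g] <= #[b1].
Proof.
move=> gG og; rewrite leqNgt; apply/negP=> lt.
have [i [j [z zG' Dg]]] := gen2_decomp defG gG.
have zG := subG' zG'; set c := b2 ^+ j * z.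
have cG : c \in G by rewrite groupM ?groupX.
have gE : g = b1 ^+ i * c by rewrite Dg mulgA.
have lec : #[g] <= #[c].
  have := order_mulg_max p_odd pG p_pr cycG' (groupX i b1G) cG.
  rewrite -gE leq_max => /orP[le|//].
  have := dvdn_leq (order_gt0 b1) (orderXdvd b1 i).
  by move/(leq_trans le); rewrite leqNgt lt.
have := order_mulg_ge p_odd pG p_pr cycG' b1G cG (leq_trans lt lec).
have [_ _ + _] := min_basis_le min_b (basis1 j zG') => /=.
have b1O : b1 \in relOhm (o b1) G C by rewrite memOC.
have gO : g \in relOhm (o b1) G C by rewrite memOC.
have cO : b1 * c \in relOhm (o b1) G C.
  by rewrite groupM // -(mulKg (b1 ^+ i) c) -gE groupM ?groupV ?groupX.
have {}cO : o (b1 * c) %| o b1 by rewrite -memOC // groupM.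
move=> /(_ (dvdn_leq (order_gt0 _) cO) (leqnn _)) le1 le2.
by have := leq_trans le2 le1; rewrite leqNgt (leq_trans lt lec).
Qed.

(** The argument of [le_b1] inside D: g and b2 lie in D, hence so does b1^i, which makes the
    exchange of b2 admissible. *)
Let le_b2 g : g \in D -> o g %| o b2 -> #[g] <= #[b2].
Proof.
move=> gD og; rewrite leqNgt; apply/negP=> lt.
have gG : g \in G := subsetP (relOhm_sub (subxx _) _) _ gD.
have defG' : G :=: <<[set b2; b1]>> by rewrite setUC.
have [j [i [z zG' Dg]]] := gen2_decomp defG' gG.
have zG := subG' zG'; set c := b1 ^+ i * z.
have cG : c \in G by rewrite groupM ?groupX.
have gE : g = b2 ^+ j * c by rewrite Dg mulgA.
have lec : #[g] <= #[c].
  have := order_mulg_max p_odd pG p_pr cycG' (groupX j b2G) cG.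
  rewrite -gE leq_max => /orP[le|//].
  have := dvdn_leq (order_gt0 b2) (orderXdvd b2 j).
  by move/(leq_trans le); rewrite leqNgt lt.
have cK : c = b2 ^- j * g by rewrite gE mulKg.
have cD : c \in D by rewrite cK groupM ?groupV ?groupX.
have zD : z \in D by apply: relG'.
have iD : b1 ^+ i \in D by rewrite -(groupMr _ zD).
have := order_mulg_ge p_odd pG p_pr cycG' b2G cG (leq_trans lt lec).
have [_ _ _] := min_basis_le min_b (basis2 iD zG') => /=.
have b2O : b2 \in relOhm (o b2) G C by rewrite memOC.
have gO : g \in relOhm (o b2) G C by rewrite memOC.
have cO : b2 * c \in relOhm (o b2) G C by rewrite groupM // cK groupM ?groupV ?groupX.
have {}cO : o (b2 * c) %| o b2 by rewrite -memOC // groupM.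
move=> /(_ (leqnn _) (dvdn_leq (order_gt0 _) cO) erefl) le1 le2.
by have := leq_trans le2 le1; rewrite leqNgt (leq_trans lt lec).
Qed.

Let exp_eq (X : {group gT}) x : X \subset G -> x \in X ->
  (forall g, g \in X -> #[g] <= #[x]) -> exponent X = #[x].
Proof.
move=> sX xX le; have [g gX E] := exponent_witness (pgroup_nil (pgroupS sX pG)).
apply/eqP; rewrite eqn_leq {1}E le //=.
by apply: dvdn_leq; [apply: exponent_gt0 | apply: dvdn_exponent].
Qed.

Let b1XD i : (b1 ^+ i \in D) = (d %| i).
Proof.
rewrite mem_relOhm // (groupX i b1G) /= -expgM -(dvdn_order_coset _ nG') //.
by rewrite -/N1 N12 dvdn_pmul2r.
Qed.

Let cosetC x : x \in C -> coset C x = 1. Proof. exact: coset_id. Qed.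

Let cosX x n : x \in G -> coset C (x ^+ n) = coset C x ^+ n.
Proof.
by move=> xG; apply: (morphX (coset_morphism C)); apply: subsetP (normal_norm nC) _ xG.
Qed.

Let cosM x y : x \in G -> y \in G -> coset C (x * y) = coset C x * coset C y.
Proof.
by move=> xG yG; apply: (morphM (coset_morphism C)); apply: subsetP (normal_norm nC) _ _.
Qed.

Let quotD : D / C = <[coset C (b1 ^+ d)]> * <[coset C b2]>.
Proof.
have nNC := normal_norm nC.
have dD : b1 ^+ d \in D by rewrite b1XD.
apply/eqP; rewrite eqEsubset mul_subG ?cycle_subG ?mem_quotient // andbT.
apply/subsetP=> _ /morphimP[g gN gD ->] /=.
have gG : g \in G := subsetP (relOhm_sub (subxx _) _) _ gD.
have [i [j [z zG' Dg]]] := gen2_decomp defG gG.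
have zC := subsetP G'C _ zG'.
have zD : z \in D by apply: relG'.
move: gD; rewrite Dg (groupMr _ zD) (groupMr _ (groupX j b2D)) b1XD => /dvdnP[l ->].
have xG : b1 ^+ d ^+ l \in G by rewrite !groupX.
have yG : b2 ^+ j \in G by rewrite groupX.
rewrite mulnC expgM (cosM (groupM xG yG) (subG' zG')) (cosetC zC) mulg1.
by rewrite (cosM xG yG) !cosX ?groupX // mem_mulg ?mem_cycle.
Qed.

Let W := #|D <*> C : C|.
Let WE : W = #|D / C|.
Proof.
rewrite /W -card_quotient; last first.
  by rewrite join_subG normG andbT (subset_trans (relOhm_sub (subxx _) _)) ?normal_norm.
rewrite joingC quotientYidl //.
by rewrite (subset_trans (relOhm_sub (subxx _) _)) ?normal_norm.
Qed.

Let card_quotC : #|G : C| = #|G / C|.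
Proof. by rewrite card_quotient ?normal_norm. Qed.

Let o_dvd_index g : g \in G -> o g %| #|G : C|.
Proof. by move=> gG; rewrite card_quotC order_dvdG ?mem_quotient. Qed.

Let tupleE (e1 e2 : nat) : e1 = #[b1] -> e2 = #[b2] ->
  basis_tuple G (b1, b2)
    = (Posz (o b1), Posz (o b2), - Posz e1, - Posz e2)%R.
Proof. by move=> -> ->. Qed.

Let expD : (forall g, g \in D -> o g %| o b2) -> exponent D = #[b2].
Proof.
move=> H; apply: exp_eq => [|//|g gD]; first exact: relOhm_sub.
exact: le_b2 (H _ gD).
Qed.

(** With b1 in C, the coset of b2 generates G/C, so every [o g] divides [o b2]: the order bounds run
    over all of C for b1 and over all of D for b2. *)
Let Oform_split1 : o b1 = 1%N -> basis_tuple G (b1, b2) =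
  Oform #|G : C| W d (exponent G) (exponent C) (exponent D).
Proof.
move=> o1; have b1C : b1 \in C by rewrite -o1E // o1.
have defG' : G :=: <<[set b2; b1]>> by rewrite setUC.
have oG : #|G : C| = o b2 by rewrite card_quotC (split_coset_gen cycG' defG' b1C).
have EW : W = o b2.
  by rewrite WE quotD cosX // (cosetC b1C) expg1n cycle1 mul1g.
rewrite /Oform EW oG eqxx -o1; apply: tupleE.
  apply: exp_eq => [|//|g gC]; first exact: normal_sub.
  have gG := subsetP (normal_sub nC) _ gC.
  by apply: le_b1; rewrite // o1 dvdn1 o1E.
apply: expD => g gD; rewrite -oG o_dvd_index //.
exact: (subsetP (relOhm_sub (subxx _) _)) gD.
Qed.

(** Otherwise a power of b2 would move b1 into C by [mulX_cent], and minimality of the first entry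
    would give o b1 = 1. *)
Let o2_lt : o b1 != 1%N -> o b2 %| o b1 /\ o b2 < o b1.
Proof.
move=> o1n; have := o_dvd b1G b2G; case/orP=> [dv|/andP[]//].
have [j jC] := mulX_cent p_odd pG p_pr cycG' b1G b2G dv.
have [le _ _ _] := min_basis_le min_b (basis1 j (group1 _)).
move: le; rewrite /= mulg1; move: (jC); rewrite -o1E ?groupM ?groupX // /o => /eqP ->.
by rewrite leqNgt ltn_neqAle eq_sym o1n order_gt0.
Qed.

(** A power of b1 moves b2 into C. The new pair need not be a basis, but it generates G, as
    [split_coset_gen] requires. *)
Let b1_gen : o b1 != 1%N -> G / C = <[coset C b1]>.
Proof.
move=> /o2_lt[dv _].
have [j jC] := mulX_cent p_odd pG p_pr cycG' b2G b1G dv.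
have defG' : G :=: <<[set b1; b2 * b1 ^+ j]>>; last first.
  exact: (split_coset_gen cycG' defG' jC).
apply/eqP; rewrite eqEsubset gen_subG subUset !sub1set b1G groupM ?groupX // andbT.
rewrite {1}defG gen_subG subUset !sub1set mem_gen ?set21 //=.
rewrite -[X in X \in _](mulgK (b1 ^+ j)).
by rewrite groupM ?groupV ?groupX ?mem_gen ?set21 ?set22.
Qed.

Let o3 := o (b1 ^+ d).

Let o3E : o3 = (o b1 %/ gcdn (o b1) d)%N.
Proof. by rewrite /o3 /o cosX // orderXgcd. Qed.

(** If d = 1, the swapped pair is a basis and minimality gives o b1 <= o b2, against [o2_lt]. *)
Let d_gt1 : o b1 != 1%N -> exists2 i, 0 < i & d = (p ^ i)%N.
Proof.
move=> o1n.
have [i Di] : exists i, d = (p ^ i)%N.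
  have [i Di] : exists i, N1 = (p ^ i)%N.
    by apply: (order_pX (quotient_pgroup G^`(1) pG)); apply: mem_quotient.
  have : d %| p ^ i by rewrite -Di N12 dvdn_mulr.
  by case/(dvdn_pfactor _ _ p_pr)=> l _ ->; exists l.
exists i => //; rewrite lt0n; apply: contraTneq (o2_lt o1n).2 => i0.
rewrite -leqNgt; have e : N1 = N2 by rewrite N12 Di i0 mul1n.
by have [] := min_basis_le min_b (basis_swap e).
Qed.

Let o3_lt : o b1 != 1%N -> o3 < o b1.
Proof.
move=> o1n; rewrite o3E; have [i i0 Di] := d_gt1 o1n.
have [l Dl] := pX b1G; rewrite ltn_Pdiv //; last exact: order_gt0.
have l0 : 0 < l by rewrite lt0n; apply: contraNneq o1n => l0; rewrite Dl l0.
rewrite Dl Di; apply: leq_trans (prime_gt1 p_pr) _.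
by rewrite dvdn_leq ?gcdn_gt0 ?expn_gt0 ?prime_gt0 // dvdn_gcd !dvdn_exp.
Qed.

Let expG : o b1 != 1%N -> exponent G = #[b1].
Proof.
move=> o1n; apply: exp_eq => // g gG; apply: le_b1 => //.
have -> : o b1 = #|G : C| by rewrite card_quotC b1_gen.
exact: o_dvd_index.
Qed.

Lemma min_basis_Oform : basis_tuple G (b1, b2) =
  Oform #|G : C| W d (exponent G) (exponent C) (exponent D).
Proof.
have [o1|o1n] := eqVneq (o b1) 1%N; first exact: Oform_split1.
have [o21 lt21] := o2_lt o1n.
have oG : #|G : C| = o b1 by rewrite card_quotC b1_gen.
have sD := relOhm_sub (subxx G^`(1)) N2.
rewrite /Oform oG -o3E.
have [o2|o2n] := eqVneq (o b2) 1%N.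
  have b2C : b2 \in C by rewrite -o1E // o2.
  have EW : W = o3 by rewrite WE quotD (cosetC b2C) cycle1 mulg1.
  rewrite EW eqxx (ltn_eqF (o3_lt o1n)).
  (* If o3 = 1 then |DC:C| = 1, so D lies in C and |b2| is the exponent of D. Otherwise d divides o
     b1, which puts C inside D, and |b2| is the exponent of C. *)
  have [o31|o3n] := eqVneq o3 1%N.
    rewrite -o2; apply: tupleE; first exact: expG.
    apply: expD => g gD; rewrite o2 -o31 -EW WE order_dvdG //.
    exact: mem_quotient.
  rewrite -o2; apply: tupleE; first exact: expG.
  apply: exp_eq => [|//|g gC]; first exact: normal_sub.
  have gG := subsetP (normal_sub nC) _ gC.
  apply: le_b2; last by rewrite o2 dvdn1 o1E.
  have [i [j [z zG' Dg]]] := gen2_decomp defG gG.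
  have zC := subsetP G'C _ zG'.
  rewrite Dg (groupMr _ (relG' _ zG')) (groupMr _ (groupX j b2D)) b1XD.
  move: gC; rewrite Dg (groupMr _ zC) (groupMr _ (groupX j b2C)).
  rewrite -(dvdn_order_coset _ nC) // => dvi; apply: dvdn_trans dvi.
  rewrite -/(o b1); have [l Dl] := pX b1G; have [m _ Dm] := d_gt1 o1n.
  rewrite Dl Dm dvdn_Pexp2l ?prime_gt1 //; apply: ltnW; rewrite ltnNge.
  apply: contraNN o3n => lm; rewrite o3E Dl Dm.
  have /gcdn_idPl -> : p ^ l %| p ^ m by rewrite dvdn_Pexp2l ?prime_gt1.
  by rewrite divnn expn_gt0 prime_gt0.
have bdG : b1 ^+ d \in G by rewrite groupX.
(* Otherwise a power of b1^d, which lies in D, would move b2 into C by an admissible exchange, and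
   the second entry would drop to 1. *)
have [o32 lt32] : o3 %| o b2 /\ o3 < o b2.
  case/orP: (o_dvd b2G bdG) => [dv|/andP[]//].
  have [j jC] := mulX_cent p_odd pG p_pr cycG' b2G bdG dv.
  have jD : b1 ^+ (d * j) \in D by rewrite b1XD dvdn_mulr.
  have [_ le _ _] := min_basis_le min_b (basis2 jD (group1 _)).
  move: (le (leqnn _)); rewrite /= mulg1 expgM.
  move: (jC); rewrite -o1E ?groupM ?groupX // /o => /eqP ->.
  by rewrite leqNgt ltn_neqAle eq_sym o2n order_gt0.
have EW : W = o b2.
  rewrite WE quotD (mulSGid (_ : <[coset C (b1 ^+ d)]> \subset <[coset C b2]>)) //.
  have cycQ : cyclic (G / C) by rewrite b1_gen ?cycle_cyclic.
  by rewrite -(cardSg_cyclic cycQ) ?cycle_subG ?mem_quotient.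
rewrite EW (ltn_eqF lt21) (gtn_eqF lt32); apply: tupleE; first exact: expG.
apply: expD => g gD; rewrite -EW WE order_dvdG //.
exact: mem_quotient.
Qed.
End MinForm.

(** * Two generators and the rank of G/G' *)

Section Rank.
Variables (gT : finGroupType) (G : {group gT}) (p : nat).
Hypotheses (pG : p.-group G) (p_pr : prime p).

(** The quotient of [relOhm p G G'] by G' is the first omega subgroup of G/G'. The rank thus becomes
    an index of canonical subgroups. *)
Lemma rank_der1_quotient :
  'r(G / G^`(1)) = logn p #|relOhm p G G^`(1) : G^`(1)|.
Proof.
have pQ : p.-group (G / G^`(1)) := quotient_pgroup _ pG.
have abQ := der_abelian 0 G.
have nG' := der_norm 1 G.
rewrite (rank_pgroup pQ) (p_rank_abelian _ abQ).
rewrite (OhmEabelian pQ) ?(abelianS (Ohm_sub _ _)) // expn1.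
rewrite -card_quotient; last by rewrite (subset_trans (relOhm_sub (subxx _) _)).
congr (logn p #|pred_of_set _|); apply/setP=> x; apply/setIP/idP.
  case=> /morphimP[g gN gG ->]; rewrite inE => /eqP gX.
  apply: mem_quotient; rewrite mem_relOhm // gG /=.
  by apply: coset_idr; rewrite ?groupX // morphX.
case/morphimP=> g gN gO ->.
move: gO; rewrite mem_relOhm // => /andP[gG gX]; rewrite inE; split.
  exact: mem_quotient.
by rewrite /= -(morphX (coset_morphism G^`(1))) //= coset_id.
Qed.

Lemma two_generated_rank : two_generated G -> 'r(G / G^`(1)) = 2.
Proof.
case=> -[x [y [xG yG defG]]] ncG.
have abQ := der_abelian 0 G; have nG' := der_norm 1 G.
apply/eqP; rewrite eqn_leq; apply/andP; split.
  rewrite -grank_abelian //=.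
  have -> : G / G^`(1) = <<[set coset G^`(1) x; coset G^`(1) y]>>.
    have -> : G / G^`(1) = <<[set x; y]>> / G^`(1) by rewrite -defG.
    rewrite quotient_gen ?quotientU ?quotient_set1 ?(subsetP nG') //.
    by rewrite subUset !sub1set !(subsetP nG').
  by apply: leq_trans (grank_min _) _; rewrite cards2; case: (_ != _).
rewrite ltnNge -abelian_rank1_cyclic //; apply: contra ncG.
case/cyclicP=> c Dc; have : c \in G / G^`(1) by rewrite Dc cycle_id.
case/morphimP=> g gN gG Eg; apply/cyclicP; exists g.
(* The trivial element pads the single generator to a pair, so that [gen2_quotient] applies. *)
have -> : <[g]> = <<[set g; 1]>>.
  apply/eqP; rewrite eqEsubset cycle_subG gen_subG subUset !sub1set.
  by rewrite mem_gen ?set21 // cycle_id group1.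
apply: (gen2_quotient pG gG (group1 G)).
by rewrite Dc Eg (coset_id (group1 _)) cycle1 mulg1.
Qed.

Lemma rank2_basis : 'r(G / G^`(1)) = 2 -> exists b, is_basis G b.
Proof.
have abQ := der_abelian 0 G; move=> r2.
have [s defQ ords] := abelian_structure abQ.
have := abelian_type_dvdn_sorted (G / G^`(1)).
have := size_abelian_type abQ; rewrite r2 -ords size_map.
case: s defQ {ords} => [|x [|y []]] //; rewrite big_cons big_cons big_nil dprodg1.
move=> defQ _ /= /andP[dv _].
have [_ defM _ _] := dprodP defQ.
have [sx sy] : <[x]> \subset G / G^`(1) /\ <[y]> \subset G / G^`(1).
  by rewrite -defM mulG_subl mulG_subr.
have /morphimP[g1 g1N g1G Ex] : x \in G / G^`(1) by rewrite -cycle_subG.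
have /morphimP[g2 g2N g2G Ey] : y \in G / G^`(1) by rewrite -cycle_subG.
by exists (g1, g2); rewrite /is_basis /= g1G g2G -Ex -Ey defQ eqxx.
Qed.

Lemma basis_two_generated : 'r(G / G^`(1)) = 2 -> two_generated G.
Proof.
move=> r2; have [[x y] bb] := rank2_basis r2.
have [xG yG _ _ _] := basisP bb; split.
  by exists x, y; split; rewrite // (basis_gen pG bb).
apply/negP=> cycG.
have := abelian_rank1_cyclic (der_abelian 0 G).
by rewrite r2 (quotient_cyclic _ cycG).
Qed.
End Rank.

(** * Group algebras *)

Import GRing.Theory.
Local Open Scope ring_scope.

(* An alias of {ffun gT -> k^o}, which already carries the pointwise product as
   its ring structure, to be equipped with convolution. *)
Definition galg (k : fieldType) (gT : finGroupType) := {ffun gT -> k^o}.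

Section GalgRing.
Variables (k : fieldType) (gT : finGroupType).
Implicit Types a b c : galg k gT.

HB.instance Definition _ := GRing.Lmodule.copy (galg k gT) {ffun gT -> k^o}.

(** The sum runs over the whole type, so the ring is the group algebra of all of gT; kG is the
    subalgebra cut out by [in_galg G], where [galg_mul G] agrees with this product. *)
Definition conv a b : galg k gT := [ffun x => \sum_y a y * b (y^-1 * x)%g].

Definition gdelta (g : gT) : galg k gT := [ffun x => (x == g)%:R].

Lemma convA : associative conv.
Proof.
move=> a b c; apply/ffunP=> x; rewrite !ffunE.
under eq_bigr => y _ do rewrite ffunE mulr_sumr.
under [RHS]eq_bigr => y _ do rewrite ffunE mulr_suml.
rewrite [RHS]exchange_big; apply: eq_bigr => y _ /=.
rewrite [RHS](reindex_inj (mulgI y)) /=; apply: eq_bigr => z _.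
by rewrite mulKg mulrA invMg mulgA.
Qed.

Lemma conv1 : left_id (gdelta 1%g) conv.
Proof.
move=> a; apply/ffunP=> x; rewrite ffunE (bigD1 1%g) //= ffunE eqxx mul1r.
rewrite invg1 mul1g big1 ?addr0 // => y /negbTE y1.
by rewrite ffunE y1 mul0r.
Qed.

Lemma conv1r : right_id (gdelta 1%g) conv.
Proof.
move=> a; apply/ffunP=> x; rewrite ffunE (bigD1 x) //= ffunE mulVg eqxx mulr1.
rewrite big1 ?addr0 // => y yx.
by rewrite ffunE -eq_mulVg1 (negbTE yx) mulr0.
Qed.

Lemma convDl : left_distributive conv +%R.
Proof.
move=> a b c; apply/ffunP=> x; rewrite !ffunE -big_split /=.
by apply: eq_bigr => y _; rewrite ffunE mulrDl.
Qed.

Lemma convDr : right_distributive conv +%R.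
Proof.
move=> a b c; apply/ffunP=> x; rewrite !ffunE -big_split /=.
by apply: eq_bigr => y _; rewrite ffunE mulrDr.
Qed.

Lemma gdelta_neq0 g : gdelta g != 0.
Proof.
by apply/eqP=> /ffunP/(_ g); rewrite !ffunE eqxx => /eqP; rewrite oner_eq0.
Qed.

HB.instance Definition _ := GRing.Zmodule_isNzRing.Build (galg k gT)
  convA conv1 conv1r convDl convDr (gdelta_neq0 1%g).

Lemma conv_scaleAl (s : k) a b : s *: (a * b) = (s *: a) * b.
Proof.
apply/ffunP=> x; rewrite !ffunE scaler_sumr.
by apply: eq_bigr => y _; rewrite ffunE -scalerAl.
Qed.

HB.instance Definition _ := GRing.Lmodule_isLalgebra.Build k (galg k gT) conv_scaleAl.

Lemma conv_scaleAr (s : k) a b : s *: (a * b) = a * (s *: b).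
Proof.
apply/ffunP=> x; rewrite !ffunE scaler_sumr.
by apply: eq_bigr => y _; rewrite ffunE -scalerAr.
Qed.

HB.instance Definition _ := GRing.Lalgebra_isAlgebra.Build k (galg k gT) conv_scaleAr.

Lemma galgM a b x : (a * b) x = \sum_y a y * b (y^-1 * x)%g.
Proof. by rewrite ffunE. Qed.

Lemma gdelta1 : gdelta 1%g = 1. Proof. by []. Qed.

Lemma gdeltaE g x : gdelta g x = (x == g)%:R. Proof. by rewrite ffunE. Qed.

Lemma gdeltaMl g a x : (gdelta g * a) x = a (g^-1 * x)%g.
Proof.
rewrite galgM (bigD1 g) //= gdeltaE eqxx mul1r big1 ?addr0 // => y /negbTE yg.
by rewrite gdeltaE yg mul0r.
Qed.

Lemma gdeltaMr g a x : (a * gdelta g) x = a (x * g^-1)%g.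
Proof.
rewrite galgM (bigD1 (x * g^-1)%g) //= gdeltaE invMg invgK mulgKV eqxx mulr1.
rewrite big1 ?addr0 // => y; rewrite gdeltaE; case: (eqVneq _ g) => [<-|_].
  by rewrite invMg invgK mulKVg eqxx.
by rewrite mulr0.
Qed.

Lemma gdeltaM g h : gdelta (g * h)%g = gdelta g * gdelta h.
Proof.
apply/ffunP=> x; rewrite gdeltaMl !gdeltaE; congr _%:R.
by rewrite -(can_eq (mulKg g) (g^-1 * x)%g) mulKVg.
Qed.

Lemma gdeltaX g n : gdelta (g ^+ n)%g = gdelta g ^+ n.
Proof. by elim: n => [|n IH]; rewrite ?expgS ?exprS ?gdeltaM ?IH. Qed.

Lemma galg_sum a : a = \sum_g (a g : k) *: gdelta g.
Proof.
apply/ffunP=> x; rewrite sum_ffunE (bigD1 x) //= !ffunE eqxx.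
rewrite big1 ?addr0 ?[RHS]mulr1 // => y yx.
by rewrite !ffunE eq_sym (negbTE yx) scaler0.
Qed.
End GalgRing.

(** * Invariant sums under p-groups in characteristic p *)

Section OrbitSum.
Variables (k : fieldType) (p : nat).
Hypothesis pk : p \in [pchar k].
Variables (aT : finGroupType) (sT : finType) (to : {action aT &-> sT}).
Variables (A : {group aT}) (S : {set sT}) (F : sT -> k).
Hypotheses (pA : p.-group A) (actS : [acts A, on S | to]).
Hypothesis invF : {in S & A, forall x a, F (to x a) = F x}.

(** F is constant on each orbit, and an orbit without fixed points has length a positive power of p,
    which is 0 in k. *)
Lemma sum_nofix : 'Fix_(S | to)(A) = set0 -> \sum_(x in S) F x = 0.
Proof.
move=> fix0; rewrite (set_partition_big _ (orbit_partition actS)) /=.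
apply: big1 => _ /imsetP[x xS ->].
rewrite (eq_bigr (fun _ => F x)) => [|_ /orbitP[a aA <-]]; last exact: invF.
have p_pr := pcharf_prime pk.
rewrite sumr_const -mulr_natr card_orbit.
have [c Dc] := p_natP (pnat_dvd (dvdn_indexg A 'C_A[x | to]) (pA : p.-nat #|A|)).
have c0 : c != 0%N.
  apply: contraTneq xS => c0; move/eqP: Dc; rewrite c0 expn0 indexg_eq1.
  rewrite subsetI subxx /= => sA.
  have : x \notin 'Fix_(S | to)(A) by rewrite fix0 inE.
  apply: contra => xS; rewrite inE xS /=; apply/afixP=> a aA.
  by have /astab1P := subsetP sA _ aA.
suff -> : #|A : 'C_A[x | to]|%:R = 0 :> k by rewrite mulr0.
by apply/eqP; rewrite -(dvdn_pcharf pk) Dc dvdn_exp // lt0n.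
Qed.
End OrbitSum.

Section OrbitSum2.
Variables (k : fieldType) (p : nat).
Hypothesis pk : p \in [pchar k].
Variables (aT : finGroupType) (sT : finType) (to : {action aT &-> sT}).
Variables (A : {group aT}) (F : sT -> k).
Hypotheses (pA : p.-group A).
Hypothesis invF : forall x a, a \in A -> F (to x a) = F x.

Lemma sum_fix : \sum_x F x = \sum_(x in 'Fix_to(A)) F x.
Proof.
rewrite (bigID (mem 'Fix_to(A))) /= [X in _ + X](_ : _ = 0) ?addr0 //.
rewrite (eq_bigl (mem (~: 'Fix_to(A)))) => [|x]; last by rewrite !inE.
have actS : [acts A, on ~: 'Fix_to(A) | to].
  rewrite astabsC; apply/subsetP=> a aA; rewrite !inE /=; apply/subsetP=> x xF.
  by rewrite inE (afixP xF a aA).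
apply: (sum_nofix pk pA actS) => [x a _|]; first exact: invF.
by apply/setP=> x; rewrite !inE andNb.
Qed.
End OrbitSum2.

(** * Linear functionals and traces of p-power elements *)

Section Trace.
Variables (k : fieldType) (gT : finGroupType) (p : nat).
Hypothesis pk : p \in [pchar k].
Variable G : {group gT}.
Implicit Types (a x y : galg k gT) (th : gT -> k).

Definition gtrace th a : k := \sum_g a g * th g.

Lemma gtrace_linear th (c : k) a b :
  gtrace th (c *: a + b) = c * gtrace th a + gtrace th b.
Proof.
rewrite /gtrace mulr_sumr -big_split; apply: eq_bigr => g _ /=.
by rewrite !ffunE mulrDl mulrA.
Qed.

Lemma gtrace_delta th g : gtrace th (gdelta k g) = th g.
Proof.
rewrite /gtrace (bigD1 g) //= gdeltaE eqxx mul1r big1 ?addr0 // => h /negbTE hg.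
by rewrite gdeltaE hg mul0r.
Qed.

Lemma gtrace_sum th (I : Type) (r : seq I) (P : pred I) (c : I -> k)
    (f : I -> galg k gT) :
  gtrace th (\sum_(i <- r | P i) c i *: f i) = \sum_(i <- r | P i) c i * gtrace th (f i).
Proof.
have t0 : gtrace th 0 = 0 by rewrite /gtrace big1 // => g _; rewrite ffunE mul0r.
elim/big_rec2: _ => [|i y1 y2 _ IH] //.
by rewrite gtrace_linear IH.
Qed.

Lemma gtraceX_words th x n : gtrace th (x ^+ n) =
  \sum_(w : {ffun 'I_n -> gT}) (\prod_i x (w i)) * th (\prod_i w i)%g.
Proof.
have -> : x ^+ n = \sum_(w : {ffun 'I_n -> gT})
    (\prod_i x (w i)) *: gdelta k (\prod_i w i)%g.
  rewrite -[n in x ^+ n]card_ord -prodr_const {1}(galg_sum x).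
  rewrite bigA_distr_bigA /=; apply: eq_bigr => w _.
  elim/big_rec3: _ => [|i g c a _ ->]; first by rewrite scale1r gdelta1.
  by rewrite gdeltaM -scalerAl -scalerAr scalerA.
by rewrite gtrace_sum; apply: eq_bigr => w _; rewrite gtrace_delta.
Qed.

Lemma sum_rotation (n e : nat) (F : {ffun 'I_n.+1 -> gT} -> k) : n.+1 = (p ^ e)%N ->
  (forall w : {ffun 'I_n.+1 -> gT}, F [ffun i => w (ordS i)] = F w) ->
  \sum_w F w = \sum_g F [ffun => g].
Proof.
move=> Dn invF; pose rt (w : {ffun 'I_n.+1 -> gT}) : {ffun 'I_n.+1 -> gT} := [ffun i => w (ordS i)].
have rt_inj : injective rt.
  move=> v w /ffunP E; apply/ffunP=> i.
  by have := E (ord_pred i); rewrite !ffunE ord_predK.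
pose s := perm rt_inj.
have iterE m (w : {ffun 'I_n.+1 -> gT}) i : (s ^+ m)%g w i = w (iter m (@ordS _) i).
  elim: m w i => [|m IH] w i; first by rewrite expg0 perm1.
  by rewrite expgS permM IH permE ffunE -iterS.
have valE m (i : 'I_n.+1) : val (iter m (@ordS _) i) = ((i + m) %% n.+1)%N.
  elim: m => [|m IH] /=; first by rewrite addn0 modn_small.
  by rewrite IH -addn1 modnDml addn1 addnS.
have s1 : (s ^+ (p ^ e) = 1)%g.
  apply/permP=> w; rewrite perm1; apply/ffunP=> i; rewrite iterE; congr (w _).
  by apply: val_inj; rewrite valE -Dn modnDr modn_small.
have ps : p.-group <[s]>%g.
  have pr := pcharf_prime pk.
  have dv : (#[s]%g %| p ^ e)%N by rewrite order_dvdn s1.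
  by rewrite /pgroup -orderE (pnat_dvd dv) // pnatX pnat_id.
rewrite (@sum_fix k p pk _ _ 'P%act <[s]>%G) //; last first.
  move=> w _ /cycleP[m ->] /=; rewrite /aperm; elim: m w => [|m IH] w.
    by rewrite expg0 perm1.
  by rewrite expgS permM IH permE; apply: invF.
have cst (w : {ffun 'I_n.+1 -> gT}) :
    (w \in 'Fix_'P(<[s]>%G)) = (w == [ffun => w ord0]).
  apply/afixP/eqP=> [fx|-> _ /cycleP[m ->]]; last first.
    by rewrite /= /aperm; apply/ffunP=> i; rewrite iterE !ffunE.
  apply/ffunP=> i; rewrite ffunE.
  have := fx _ (mem_cycle s i); rewrite /= /aperm => /ffunP/(_ ord0).
  rewrite iterE => <-; congr (w _); apply: val_inj.
  by rewrite valE add0n modn_small.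
rewrite (eq_bigl _ _ cst).
rewrite (reindex_onto (fun g => [ffun => g] : {ffun 'I_n.+1 -> gT}) (fun w => w ord0)) /=.
  by apply: eq_bigl => g; rewrite !ffunE !eqxx.
by move=> w /eqP <-.
Qed.

(* The cyclic group of order p^e rotates the words of length p^e occurring in the
   expansion of x^(p^e); only the constant words are fixed. *)
Lemma gtraceX_p th x e : in_galg G x ->
  {in G &, forall g h, th (g * h)%g = th (h * g)%g} ->
  gtrace th (x ^+ (p ^ e)) = \sum_g x g ^+ (p ^ e) * th (g ^+ (p ^ e))%g.
Proof.
move=> /forallP xG thC.
suff aux n : n.+1 = (p ^ e)%N ->
    gtrace th (x ^+ n.+1) = \sum_g x g ^+ n.+1 * th (g ^+ n.+1)%g.
  by have := aux (p ^ e)%N.-1; rewrite prednK ?expn_gt0 ?prime_gt0 ?(pcharf_prime pk) //; apply.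
move=> Dn; rewrite gtraceX_words (sum_rotation Dn).
  apply: eq_bigr => g _; congr (_ * th _).
    rewrite (eq_bigr (fun _ => x g)) => [|i _]; last by rewrite ffunE.
    by rewrite prodr_const card_ord.
  rewrite (eq_bigr (fun _ => g)) => [|i _]; last by rewrite ffunE.
  by rewrite big_const_ord; elim: _.+1 => //= m ->; rewrite expgS.
move=> w; rewrite (eq_bigr (fun i => x (w (ordS i)))) => [|i _]; last by rewrite ffunE.
have -> : \prod_i x (w (ordS i)) = \prod_i x (w i).
  by rewrite [RHS](reindex_inj (can_inj (@ordSK _))).
(* [th] is symmetric only on G: a word with a letter outside G has coefficient 0, and for the others
   symmetry moves the rotated letter from the end back to the front. *)
have [/forallP wG|] := boolP [forall i, w i \in G]; last first.
  by case/forallPn=> i /(implyP (xG _))/eqP xi; rewrite (bigD1 i) //= xi !mul0r.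
congr (_ * _); rewrite big_ord_recr [in RHS]big_ord_recl /= !ffunE.
have -> : ordS (ord_max : 'I_n.+1) = ord0 by apply: val_inj; rewrite /= modnn.
rewrite thC ?group_prod //.
congr (th (_ * _)%g); apply: eq_bigr => i _; rewrite ffunE; congr (w _).
apply: val_inj; rewrite /= modn_small // /bump /=.
by rewrite ltnS.
Qed.
End Trace.

(** * Elements supported on G *)

Section Closure.
Variables (k : fieldType) (gT : finGroupType) (G : {group gT}).
Implicit Types a b : galg k gT.

Lemma in_galgP a : reflect (forall g, g \notin G -> a g = 0) (in_galg G a).
Proof.
by apply: (iffP forallP) => H g; [move/(implyP (H g))/eqP | apply/implyP=> /H->].
Qed.

Lemma in_galg_lin (c : k) a b : in_galg G a -> in_galg G b -> in_galg G (c *: a + b).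
Proof.
move=> /in_galgP aG /in_galgP bG; apply/in_galgP=> g gG.
by rewrite !ffunE aG // bG // scaler0 addr0.
Qed.

Lemma in_galg0 : in_galg G (0 : galg k gT).
Proof. by apply/in_galgP=> g _; rewrite ffunE. Qed.

Lemma in_galg_delta g : g \in G -> in_galg G (gdelta k g).
Proof. by move=> gG; apply/in_galgP=> h; rewrite gdeltaE; case: eqP => // ->; rewrite gG. Qed.

Lemma in_galg1 : in_galg G (1 : galg k gT).
Proof. exact: in_galg_delta. Qed.

Lemma in_galgM a b : in_galg G a -> in_galg G b -> in_galg G (a * b).
Proof.
move=> /in_galgP aG /in_galgP bG; apply/in_galgP=> g gG.
rewrite galgM big1 // => y _; have [yG|/aG->] := boolP (y \in G); last exact: mul0r.
by rewrite bG ?mulr0 // groupMl ?groupV.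
Qed.

Lemma in_galgD a b : in_galg G a -> in_galg G b -> in_galg G (a + b).
Proof. by move=> aG bG; rewrite -[a]scale1r in_galg_lin. Qed.

Lemma in_galgZ (c : k) a : in_galg G a -> in_galg G (c *: a).
Proof. by move=> aG; rewrite -[_ *: _]addr0 in_galg_lin ?in_galg0. Qed.

Lemma in_galgB a b : in_galg G a -> in_galg G b -> in_galg G (a - b).
Proof. by move=> aG bG; rewrite in_galgD // -scaleN1r in_galgZ. Qed.

Lemma in_galgX a n : in_galg G a -> in_galg G (a ^+ n).
Proof. by move=> aG; elim: n => [|n IH]; rewrite ?in_galg1 // exprS in_galgM. Qed.

Lemma in_galg_sum (I : Type) (r : seq I) (P : pred I) (F : I -> galg k gT) :
  (forall i, P i -> in_galg G (F i)) -> in_galg G (\sum_(i <- r | P i) F i).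
Proof. by move=> FG; elim/big_ind: _ => //; [apply: in_galg0 | apply: in_galgD]. Qed.

Lemma galg_sumG a : in_galg G a -> a = \sum_(g in G) (a g : k) *: gdelta k g.
Proof.
move/in_galgP=> aG; rewrite {1}(galg_sum a) [LHS](bigID (mem G)) /=.
by rewrite [X in _ + X]big1 ?addr0 // => g /aG->; rewrite scale0r.
Qed.

Lemma galg_mulE a b : in_galg G a -> galg_mul G a b = a * b :> galg k gT.
Proof.
move/in_galgP=> aG; apply/ffunP=> x; rewrite galgM ffunE [RHS](bigID (mem G)) /=.
by rewrite [X in _ + X]big1 ?addr0 // => g /aG->; rewrite mul0r.
Qed.
End Closure.

Section GtraceMore.
Variables (k : fieldType) (gT : finGroupType) (G : {group gT}).
Implicit Types (a b : galg k gT) (phi : gT -> k).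

Lemma gtraceD phi a b : gtrace phi (a + b) = gtrace phi a + gtrace phi b.
Proof. by rewrite -[a in LHS]scale1r gtrace_linear mul1r. Qed.

Lemma gtraceZ phi c a : gtrace phi (c *: a) = c * gtrace phi a.
Proof.
rewrite -[_ *: _]addr0 gtrace_linear [X in _ + X](_ : _ = 0) ?addr0 //.
by rewrite /gtrace big1 // => g _; rewrite ffunE mul0r.
Qed.

Lemma gtraceB phi a b : gtrace phi (a - b) = gtrace phi a - gtrace phi b.
Proof. by rewrite gtraceD -scaleN1r gtraceZ mulN1r. Qed.

Lemma gtraceMr phi a b :
  gtrace phi (a * b) = \sum_h b h * gtrace (fun g => phi (g * h)%g) a.
Proof.
rewrite {1}(galg_sum b) mulr_sumr.
rewrite (eq_bigr (fun h => b h *: (a * gdelta k h))) => [|h _]; last by rewrite -scalerAr.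
rewrite gtrace_sum; apply: eq_bigr => h _; congr (_ * _).
rewrite /gtrace (reindex_inj (mulIg h)) /=; apply: eq_bigr => g _.
by rewrite gdeltaMr mulgK.
Qed.

Lemma gtraceMl phi a b :
  gtrace phi (a * b) = \sum_h a h * gtrace (fun g => phi (h * g)%g) b.
Proof.
rewrite {1}(galg_sum a) mulr_suml.
rewrite (eq_bigr (fun h => a h *: (gdelta k h * b))) => [|h _]; last by rewrite -scalerAl.
rewrite gtrace_sum; apply: eq_bigr => h _; congr (_ * _).
rewrite /gtrace (reindex_inj (mulgI h)) /=; apply: eq_bigr => g _.
by rewrite gdeltaMl mulKg.
Qed.

Lemma gtrace_in phi a : in_galg G a -> gtrace phi a = \sum_(g in G) a g * phi g.
Proof.
move/in_galgP=> aG; rewrite /gtrace (bigID (mem G)) /=.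
by rewrite [X in _ + X]big1 ?addr0 // => g /aG->; rewrite mul0r.
Qed.
End GtraceMore.

(** * The ideals I(N)kG *)

Section Aug.
Variables (k : fieldType) (gT : finGroupType) (G : {group gT}).
Implicit Types (a b x y : galg k gT) (phi : gT -> k) (N M : {group gT}).

Definition left_inv N phi := forall n g, n \in N -> g \in G -> phi (n * g)%g = phi g.

(* The ideal I(N)kG, the kernel of kG -> k[G/N], as the annihilator of the
   functions on G that are constant on the cosets of N. *)
Definition in_aug N x := in_galg G x /\ forall phi, left_inv N phi -> gtrace phi x = 0.

Lemma in_aug_lin N (c : k) a b : in_aug N a -> in_aug N b -> in_aug N (c *: a + b).
Proof.
move=> [aG a0] [bG b0]; split=> [|phi Hphi]; first exact: in_galg_lin.
by rewrite gtrace_linear a0 // b0 // mulr0 addr0.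
Qed.

Lemma in_aug0 N : in_aug N 0.
Proof.
split=> [|phi _]; first exact: in_galg0.
by rewrite /gtrace big1 // => g _; rewrite ffunE mul0r.
Qed.

Lemma in_augD N a b : in_aug N a -> in_aug N b -> in_aug N (a + b).
Proof. by move=> aI bI; rewrite -[a]scale1r; apply: in_aug_lin. Qed.

Lemma in_augS N M a : N \subset M -> in_aug N a -> in_aug M a.
Proof.
move=> sNM [aG a0]; split=> // phi Hphi; apply: a0 => n g nN.
exact/Hphi/(subsetP sNM).
Qed.

Lemma in_augMr N a b : in_aug N a -> in_galg G b -> in_aug N (a * b).
Proof.
move=> [aG a0] bG; split=> [|phi Hphi]; first exact: in_galgM.
rewrite gtraceMr big1 // => h _; have [hG|hG] := boolP (h \in G); last first.
  by rewrite (in_galgP _ _ bG) ?mul0r.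
by rewrite a0 ?mulr0 // => n g nN gG; rewrite -mulgA Hphi ?groupM.
Qed.

Lemma in_augMl N a b : N <| G -> in_aug N a -> in_galg G b -> in_aug N (b * a).
Proof.
move=> nN [aG a0] bG; split=> [|phi Hphi]; first exact: in_galgM.
rewrite gtraceMl big1 // => h _; have [hG|hG] := boolP (h \in G); last first.
  by rewrite (in_galgP _ _ bG) ?mul0r.
rewrite a0 ?mulr0 // => n g nN' gG.
have -> : (h * (n * g) = n ^ h^-1 * (h * g))%g by rewrite conjgE invgK !mulgA mulgKV.
apply: Hphi; last exact: groupM.
by rewrite memJ_norm // (subsetP (normal_norm nN)) ?groupV.
Qed.

Let rp N g := repr (N :* g).

Let rp_inv N : {in N, forall n g, rp N (n * g)%g = rp N g}.
Proof. by move=> n nN g; rewrite /rp rcosetM rcoset_id. Qed.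

Let rp_coset N g : exists2 n, n \in N & g = (n * rp N g)%g.
Proof.
have /rcosetP[n nN E] := mem_repr_rcoset N g.
by exists n^-1%g; rewrite ?groupV // /rp E mulKg.
Qed.

(** The differences ng - g span the ideal: testing x against coset indicators gives sum_g x_g rp(g)
    = 0, so x = sum_g x_g (g - rp(g)). *)
Lemma aug_ind N (P : galg k gT -> Prop) : N \subset G -> P 0 ->
    (forall c a b, in_galg G a -> in_galg G b -> P a -> P b -> P (c *: a + b)) ->
    (forall n g, n \in N -> g \in G -> P (gdelta k (n * g)%g - gdelta k g)) ->
  forall x, in_aug N x -> P x.
Proof.
move=> sNG P0 PL Pd x [xG x0].
have rpG g : g \in G -> rp N g \in G.
  move=> gG; have [n nN E] := rp_coset N g.
  by rewrite -(groupMl _ (subsetP sNG _ nN)) -E.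
have E0 : \sum_(g in G) (x g : k) *: gdelta k (rp N g) = 0.
  apply/ffunP=> h; rewrite sum_ffunE ffunE.
  rewrite -[RHS](x0 (fun g => (h == rp N g)%:R)) => [|n g nN _]; last by rewrite rp_inv.
  by rewrite (gtrace_in _ xG); apply: eq_bigr => g _; rewrite !ffunE.
have -> : x = \sum_(g in G) (x g : k) *: (gdelta k g - gdelta k (rp N g)).
  under eq_bigr => g _ do rewrite scalerBr.
  by rewrite sumrB E0 subr0 -galg_sumG.
suff [] : in_galg G (\sum_(g in G) (x g : k) *: (gdelta k g - gdelta k (rp N g))) /\
          P (\sum_(g in G) (x g : k) *: (gdelta k g - gdelta k (rp N g))) by [].
elim/big_rec: _ => [|g y gG [yG Py]]; first by split=> //; apply: in_galg0.
have dG : in_galg G (gdelta k g - gdelta k (rp N g)).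
  by rewrite in_galgB ?in_galg_delta ?rpG.
split; first exact: in_galg_lin.
apply: PL => //; have [n nN {1}->] := rp_coset N g.
by apply: Pd => //; apply: rpG.
Qed.

Section Frobenius.
Variables (p : nat).
Hypothesis pk : p \in [pchar k].

Let zX e : 0 ^+ (p ^ e) = 0 :> k.
Proof. by rewrite expr0n gtn_eqF // expn_gt0 prime_gt0 // (pcharf_prime pk). Qed.

Lemma sum_pX (I : Type) (r : seq I) (P : pred I) (F : I -> k) e :
  (\sum_(i <- r | P i) F i) ^+ (p ^ e) = \sum_(i <- r | P i) F i ^+ (p ^ e).
Proof.
have p_pr := pcharf_prime pk.
elim/big_rec2: _ => [|i x y _ <-]; first exact: zX.
by apply: exprDn_pchar; rewrite (eq_pnat _ (pcharf_eq pk)) pnatX pnat_id.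
Qed.

(** On a coset of N, [th] is constant and the p^e-th powers of the coefficients add up to the p^e-th
    power of their sum, which is 0. *)
Lemma gtrace_aug_pX N x e th : N \subset G -> in_aug N x -> left_inv N th ->
  \sum_(g in G) x g ^+ (p ^ e) * th g = 0.
Proof.
move=> sNG [xG x0] Hth.
rewrite (partition_big (rp N) xpredT) //=; apply: big1 => r _.
rewrite (eq_bigr (fun g => x g ^+ (p ^ e) * th r)) => [|g /andP[gG /eqP <-]]; last first.
  have [n nN E] := rp_coset N g; rewrite {2}E Hth //.
  by rewrite -(groupMl _ (subsetP sNG _ nN)) -E.
rewrite -mulr_suml -sum_pX.
have := x0 (fun g => (rp N g == r)%:R); rewrite (gtrace_in _ xG) => x1.
suff -> : \sum_(g in G | rp N g == r) x g = 0.
  by rewrite zX mul0r.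
rewrite -[RHS]x1 => [|n g nN _]; last by rewrite rp_inv.
by rewrite big_mkcondr; apply: eq_bigr => g _; case: eqP; rewrite ?mulr1 ?mulr0.
Qed.

(** For a coset O g0, the form [th] is the indicator of the coset N g0^(p^e), symmetric because G'
    <= N. As g^(p^e) lies in that coset iff g lies in O g0, the trace formula makes the p^e-th power
    of the coefficient sum of x over O g0 vanish, hence also the sum. *)
Lemma in_aug_root N x e : N <| G -> G^`(1)%g \subset N -> in_galg G x ->
  in_aug N (x ^+ (p ^ e)) -> in_aug [group of relOhm (p ^ e) G N] x.
Proof.
move=> nNG sG'N xG [_ xX0]; split=> // phi Hphi.
set O := [group of _] in Hphi *.
have sOG : O \subset G := relOhm_sub sG'N _.
rewrite (gtrace_in _ xG) (partition_big (rp O) xpredT) //=; apply: big1 => r _.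
rewrite (eq_bigr (fun g => x g * phi r)) => [|g /andP[gG /eqP <-]]; last first.
  have [n nN E] := rp_coset O g; rewrite {2}E Hphi //.
  by rewrite -(groupMl _ (subsetP sOG _ nN)) -E.
rewrite -mulr_suml; suff -> : \sum_(g in G | rp O g == r) x g = 0 by rewrite mul0r.
have [g0 /andP[g0G /eqP Er]|none] := pickP [pred g | (g \in G) && (rp O g == r)]; last first.
  by apply: big_pred0 => g; have := none g.
apply/eqP; have := expf_eq0 (\sum_(g in G | rp O g == r) x g) (p ^ e).
rewrite expn_gt0 prime_gt0 ?(pcharf_prime pk) //= => <-.
rewrite sum_pX; pose th g : k := (g * g0 ^- (p ^ e) \in N)%g%:R.
have comm g h c : g \in G -> h \in G -> c \in G -> (g * h * c \in N)%g = (h * g * c \in N)%g.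
  move=> gG hG cG; have -> : (g * h * c = [~ g^-1, h^-1] * (h * g * c))%g.
    by rewrite commgEl conjgE !invgK !mulgA !mulgKV.
  by rewrite groupMl // (subsetP sG'N) // mem_commg ?groupV.
have thC : {in G &, forall g h, th (g * h)%g = th (h * g)%g}.
  by move=> g h gG hG; rewrite /th comm // groupV groupX.
have thN : left_inv N th.
  by move=> n g nN gG; rewrite /th -mulgA groupMl.
have := xX0 _ thN; rewrite (gtraceX_p pk e xG thC) => E0.
apply/eqP; rewrite -[RHS]E0 [RHS](bigID (mem G)) /= [X in _ = _ + X]big1 ?addr0; last first.
  move=> g gG; by rewrite (in_galgP _ _ xG) // zX mul0r.
rewrite big_mkcondr; apply: eq_bigr => g gG; rewrite /th.
have -> : (rp O g == r) = (g ^+ (p ^ e) * g0 ^- (p ^ e) \in N)%g.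
  have -> : (rp O g == r) = (g * g0^-1 \in O)%g.
    rewrite -Er -mem_rcoset; apply/eqP/idP => [E|gO].
      have [n nN ->] := rp_coset O g; rewrite E.
      have [m mN {2}->] := rp_coset O g0.
      by rewrite mem_rcoset invMg mulgA mulgK groupM ?groupV.
    by rewrite /rp (rcoset_eqP gO).
  rewrite mem_relOhm // groupM ?groupV //=.
  have [z zG' ->] := expgM_der1 (p ^ e) gG (groupVr g0G).
  by rewrite (groupMr _ (subsetP sG'N _ zG')) expgVn.
by case: (_ \in N); rewrite ?mulr1 ?mulr0.
Qed.

(* G acts by conjugation without fixed points outside Z(G), so only the
   coefficients of x on Z(G) contribute to any functional. *)
Lemma in_aug_center x : p.-group G -> in_galg G x ->
  (forall h, h \in G -> x * gdelta k h = gdelta k h * x) ->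
  gtrace (fun=> 1) x = 0 ->
  in_aug ('Z(G) <*> G^`(1))%G x.
Proof.
move=> pG xG xC x1; split=> // phi Hphi.
have xJ g h : h \in G -> x (g ^ h)%g = x g.
  move=> hG; have := congr1 (fun y : galg k gT => y (h * (g ^ h))%g) (xC h hG).
  by rewrite /= gdeltaMr gdeltaMl mulKg conjgE !mulgA mulgV mul1g mulgK.
have nc F : (forall g h, g \in G -> h \in G -> F (g ^ h)%g = F g) ->
    \sum_(g in G :\: 'Z(G)) x g * F g = 0.
  move=> FJ; apply: (@sum_nofix k p pk _ _ 'J%act G) => //.
  - apply/subsetP=> h hG; rewrite !inE /=; apply/subsetP=> g /setDP[gG gZ].
    rewrite inE inE memJ_norm ?gZ ?groupJ // ?(subsetP (normal_norm (center_normal G))) //.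
  - by move=> g h /setDP[gG _] hG /=; rewrite xJ // FJ.
  apply/setP=> g; rewrite [RHS]inE; apply/negP=> /setIP[/setDP[gG gZ] /afixP gf].
  case/negP: gZ; apply/setIP; split=> //; apply/centP=> h hG.
  by have /= := gf h hG => /conjg_fixP; apply/commgP.
have split F : (forall g h, g \in G -> h \in G -> F (g ^ h)%g = F g) ->
    gtrace F x = \sum_(g in 'Z(G)) x g * F g.
  move=> FJ; rewrite (gtrace_in _ xG) (big_setID 'Z(G)) /= nc // addr0.
  by rewrite (setIidPr (center_sub G)).
rewrite split => [|g h gG hG]; last first.
  have -> : (g ^ h = [~ h, g^-1] * g)%g by rewrite commgEr conjgE invgK mulgKV conjgE.
  by rewrite Hphi // (subsetP (joing_subr _ _)) // mem_commg ?groupV.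
(* On Z(G) the functional is the constant [phi 1], so a multiple of the augmentation of x
   remains. *)
rewrite (eq_bigr (fun g => x g * phi 1%g)) => [|g gZ]; last first.
  by rewrite -[g in phi g]mulg1 Hphi // (subsetP (joing_subl _ _)).
rewrite -mulr_suml; move: x1; rewrite split // => x1.
by rewrite (_ : \sum_(g in 'Z(G)) x g = 0) ?mul0r // -[RHS]x1; apply: eq_bigr => g _; rewrite mulr1.
Qed.

(** Regularity makes g -> g^(p^e) constant on the cosets of N, so [gtrace_aug_pX] applies to its
    composite with [th]. *)
Lemma gtrace_aug_exponent N x e th : odd p -> p.-group G -> cyclic G^`(1) ->
  N <| G -> (exponent N %| p ^ e)%N -> in_aug N x ->
  {in G &, forall g h, th (g * h)%g = th (h * g)%g} ->
  gtrace th (x ^+ (p ^ e)) = 0.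
Proof.
move=> p_odd pG cycG' nNG expN [xG x0] thC.
have p_pr := pcharf_prime pk; have sNG := normal_sub nNG.
rewrite (gtraceX_p pk e xG thC) (bigID (mem G)) /= [X in _ + X]big1 ?addr0; last first.
  move=> g gG; by rewrite (in_galgP _ _ xG) // zX mul0r.
apply: (@gtrace_aug_pX N x e (fun g => th (g ^+ (p ^ e))%g)) => //.
move=> n g nN gG; have nG := subsetP sNG _ nN.
have -> : (n * g = g * n ^ g)%g by rewrite conjgC.
rewrite (expgM_pX_eq p_odd pG p_pr cycG') ?groupJ //.
by rewrite -conjXg (exponentP expN) // conj1g.
Qed.

End Frobenius.
End Aug.

(** * Isomorphisms of group algebras *)

(* The maps are total on functions gT -> k but only constrained on kG and kH. *)
Record galg_isom (k : fieldType) (gT hT : finGroupType) (G : {group gT})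
    (H : {group hT}) (f : galg k gT -> galg k hT) (f' : galg k hT -> galg k gT) : Prop :=
  GalgIsom {
    isom_in : forall a : galg k gT, in_galg G a -> in_galg H (f a);
    isom_lin : forall (c : k) (a b : galg k gT), in_galg G a -> in_galg G b ->
      f (c *: a + b) = c *: f a + f b;
    isom_inv_in : forall b : galg k hT, in_galg H b -> in_galg G (f' b);
    isom_K : forall a : galg k gT, in_galg G a -> f' (f a) = a;
    isom_invK : forall b : galg k hT, in_galg H b -> f (f' b) = b;
    isom1 : f 1 = 1;
    isomM : forall a b : galg k gT, in_galg G a -> in_galg G b -> f (a * b) = f a * f b
  }.

Lemma galg_isom_sym k gT hT (G : {group gT}) (H : {group hT}) f f' :
  @galg_isom k gT hT G H f f' -> galg_isom H G f' f.
Proof.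
case=> fG fL f'H fK f'K f1 fM; split=> //.
- move=> c a b aH bH; have [aG bG] := (f'H _ aH, f'H _ bH).
  by rewrite -[RHS]fK ?in_galg_lin // fL // !f'K.
- by rewrite -f1 fK // in_galg1.
- move=> a b aH bH; have [aG bG] := (f'H _ aH, f'H _ bH).
  by rewrite -[RHS]fK ?in_galgM // fM // !f'K.
Qed.

Lemma galg_iso_isom k gT hT (G : {group gT}) (H : {group hT}) :
  galg_iso k G H -> exists f f', @galg_isom k gT hT G H f f'.
Proof.
case=> f [fG fL [f_inj f_surj] f1 fM].
have ex (b : galg k hT) : in_galg H b -> exists a : galg k gT, in_galg G a && (f a == b).
  by move=> /f_surj[a aG fa]; exists a; apply/andP; split; [exact: aG | apply/eqP].
(* Choosing a preimage requires a proof that b lies in kH; outside kH the default value is 0. *)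
pose f' (b : galg k hT) : galg k gT :=
  if decP (@idP (in_galg H b)) is left bH then xchoose (ex b bH) else 0.
have f'P (b : galg k hT) : in_galg H b -> in_galg G (f' b) && (f (f' b) == b).
  rewrite /f'; case: decP => // bH _.
  exact: (xchooseP (ex b bH)).
exists f, f'; split=> //.
- move=> c a b aG bG; have -> : c *: a + b = [ffun x => c * a x + b x] :> galg k gT.
    by apply/ffunP=> x; rewrite !ffunE.
  by rewrite fL //; apply/ffunP=> x; rewrite !ffunE.
- by move=> b /f'P/andP[].
- move=> a aG; have /andP[bG /eqP E] := f'P _ (fG _ aG).
  exact: f_inj E.
- by move=> b /f'P/andP[_ /eqP].
- move=> a b aG bG; rewrite -(galg_mulE b aG) fM //.
  exact: galg_mulE (fG _ aG).
Qed.

Section IsomSum.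
Variables (k : fieldType) (gT hT : finGroupType) (G : {group gT}) (H : {group hT}).
Variables (f : galg k gT -> galg k hT) (f' : galg k hT -> galg k gT).
Hypothesis isof : galg_isom G H f f'.
Let fL := isom_lin isof.

Lemma isom0 : f 0 = 0.
Proof.
have := fL (-1) (in_galg0 k G) (in_galg0 k G).
by rewrite !scaleN1r oppr0 addr0 addNr.
Qed.

Lemma isom_sumE (x : galg k gT) : in_galg G x -> f x = \sum_(g in G) (x g : k) *: f (gdelta k g).
Proof.
move=> xG; rewrite {1}(galg_sumG xG).
suff [] : in_galg G (\sum_(g in G) (x g : k) *: gdelta k g) /\
    f (\sum_(g in G) (x g : k) *: gdelta k g) = \sum_(g in G) (x g : k) *: f (gdelta k g) by [].
elim/big_rec2: _ => [|g y1 y2 gG [yG <-]]; first by split; [apply: in_galg0 | apply: isom0].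
by split; [apply: in_galg_lin => //; apply: in_galg_delta | rewrite fL ?in_galg_delta].
Qed.

Lemma isomB (a b : galg k gT) :
  in_galg G a -> in_galg G b -> f (a - b) = f a - f b.
Proof. by move=> aG bG; rewrite addrC -scaleN1r fL // scaleN1r addrC. Qed.
End IsomSum.

(** * Transport of the ideals I(N)kG along an isomorphism *)

Section Isom.
Variables (k : fieldType) (gT hT : finGroupType) (G : {group gT}) (H : {group hT}).
Variables (f : galg k gT -> galg k hT) (f' : galg k hT -> galg k gT).
Hypothesis isof : galg_isom G H f f'.
Implicit Types (N : {group gT}) (M : {group hT}).

Let fG := isom_in isof.
Let fL := isom_lin isof.
Let f1 := isom1 isof.
Let fM := isomM isof.

Let fB := isomB isof.

Let fX (a : galg k gT) n : in_galg G a -> f (a ^+ n) = f a ^+ n.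
Proof.
move=> aG; elim: n => [|n IH]; first by rewrite !expr0.
by rewrite !exprS fM ?in_galgX // IH.
Qed.

Let dG g : g \in G -> in_galg G (gdelta k g). Proof. exact: in_galg_delta. Qed.
Let fdH g : g \in G -> in_galg H (f (gdelta k g)). Proof. by move/dG/fG. Qed.

(* Equivalent to f mapping I(N)kG into I(M)kH. *)
Definition isom_sub N M := forall n, n \in N -> in_aug H M (f (gdelta k n) - 1).

Lemma isom_sub_delta N M n g : N \subset G -> isom_sub N M -> n \in N -> g \in G ->
  in_aug H M (f (gdelta k (n * g)%g - gdelta k g)).
Proof.
move=> sNG NM nN gG; have nG := subsetP sNG _ nN.
rewrite fB ?dG ?groupM // gdeltaM fM ?dG //.
rewrite -{2}[f (gdelta k g)]mul1r -mulrBl.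
by apply: in_augMr; [apply: NM | apply: fdH].
Qed.

Lemma isom_sub_gen (A : {set gT}) M : A \subset G -> M <| H ->
  (forall n, n \in A -> in_aug H M (f (gdelta k n) - 1)) ->
  forall n, n \in <<A>>%g -> in_aug H M (f (gdelta k n) - 1).
Proof.
move=> sAG nM AM n /gen_prodgP[r [c cA ->]].
have aux (s : seq 'I_r) : (\prod_(i <- s) c i \in G)%g /\
    in_aug H M (f (gdelta k (\prod_(i <- s) c i)%g) - 1).
  elim: s => [|i s [sG sI]].
    by rewrite !big_nil group1 gdelta1 f1 subrr; split=> //; apply: in_aug0.
  have ciG := subsetP sAG _ (cA i).
  rewrite !big_cons groupM //; split=> //.
  rewrite gdeltaM fM ?dG //.
  set a := f (gdelta k (c i)); set b := f _.
  have -> : a * b - 1 = (a - 1) * b + (b - 1) by rewrite mulrBl mul1r subrKA.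
  by apply: in_augD => //; apply: in_augMr; [apply: AM | apply: fdH].
by have [] := aux (index_enum _).
Qed.

Lemma isom_subY N N' M M' : N \subset G -> N' \subset G -> M <| H -> M' <| H ->
  isom_sub N M -> isom_sub N' M' -> isom_sub (N <*> N')%G (M <*> M')%G.
Proof.
move=> sN sN' nM nM' NM NM'; apply: isom_sub_gen; rewrite ?subUset ?sN //.
  exact: normalY.
move=> n /setUP[/NM|/NM']; apply: in_augS; [exact: joing_subl | exact: joing_subr].
Qed.

Lemma in_aug_comm (a b : galg k hT) : in_galg H a -> in_galg H b ->
  in_aug H (H^`(1))%G (a * b - b * a).
Proof.
move=> aH bH; split=> [|phi Hphi]; first by rewrite in_galgB ?in_galgM.
rewrite gtraceB gtraceMl gtraceMr; apply/eqP; rewrite subr_eq0; apply/eqP.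
apply: eq_bigr => h _; have [hH|hH] := boolP (h \in H); last first.
  by rewrite (in_galgP _ _ aH) ?mul0r.
congr (_ * _); rewrite !(gtrace_in _ bH); apply: eq_bigr => g gH; congr (_ * _).
have -> : (h * g = [~ h^-1, g^-1] * (g * h))%g.
  by rewrite commgEl conjgE !invgK !mulgA !mulgKV.
apply: Hphi; last exact: groupM.
by apply: mem_commg; rewrite groupV.
Qed.

(** [x, y] - 1 = (yx)^-1 (xy - yx), and ring commutators of kH lie in I(H')kH. *)
Lemma isom_sub_der1 : isom_sub (G^`(1))%G (H^`(1))%G.
Proof.
apply: isom_sub_gen (der_normal 1 H) _.
  by apply/subsetP=> _ /imset2P[x y xG yG ->]; rewrite groupR.
move=> _ /imset2P[x y xG yG ->]; rewrite commgEl conjgE.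
set dx := f (gdelta k x); set dy := f (gdelta k y).
have -> : (x^-1 * (y^-1 * (x * y)) = (y * x)^-1 * (x * y))%g by rewrite invMg !mulgA.
rewrite gdeltaM fM ?dG ?groupV ?groupM //.
set v := f (gdelta k (y * x)^-1)%g.
have -> : 1 = v * f (gdelta k (y * x)%g).
  by rewrite -fM ?dG ?groupV ?groupM // -gdeltaM mulVg gdelta1 f1.
rewrite -mulrBr !gdeltaM !fM ?dG //.
apply: in_augMl; rewrite ?der_normal //; last by rewrite fdH ?groupV ?groupM.
by apply: in_aug_comm; apply: fdH.
Qed.

Section Char.
Variable p : nat.
Hypotheses (pk : p \in [pchar k]) (pG : p.-group G) (pH : p.-group H).
Let p_pr := pcharf_prime pk.

Lemma subr1_pX (a : galg k hT) e : (a - 1) ^+ (p ^ e) = a ^+ (p ^ e) - 1.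
Proof.
have pA : p \in [pchar (galg k hT)] by rewrite pchar_lalg.
elim: e => [|e IH]; first by rewrite !expr1.
rewrite expnSr !exprM IH -!(pFrobenius_autE pA) pFrobenius_autB_comm.
  by rewrite (pFrobenius_autE pA 1) expr1n.
exact: commr1.
Qed.

Let isom_deltaX n e : n \in G ->
  (f (gdelta k n) - 1) ^+ (p ^ e) = f (gdelta k (n ^+ (p ^ e))%g) - 1.
Proof. by move=> nG; rewrite subr1_pX gdeltaX fX ?dG. Qed.

Let sub1H n : n \in G -> in_galg H (f (gdelta k n) - 1).
Proof. by move=> nG; rewrite in_galgB ?in_galg1 ?fdH. Qed.

Lemma isom_sub_root N M e : M <| H -> G^`(1)%g \subset N -> H^`(1)%g \subset M ->
  isom_sub N M ->
  isom_sub [group of relOhm (p ^ e) G N] [group of relOhm (p ^ e) H M].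
Proof.
move=> nM sN sM NM n; rewrite mem_relOhm // => /andP[nG nN].
apply: (in_aug_root pk) => //; first exact: sub1H.
by rewrite isom_deltaX //; apply: NM.
Qed.

Lemma isom_sub_center : isom_sub ('Z(G) <*> G^`(1))%G ('Z(H) <*> H^`(1))%G.
Proof.
have nZ : ('Z(H) <*> H^`(1))%G <| H.
  by rewrite /= normalY ?center_normal ?der_normal.
apply: isom_sub_gen nZ _; first by rewrite subUset center_sub der_sub.
move=> n /setUP[nZn|nG']; last first.
  by apply: in_augS (isom_sub_der1 nG'); apply: joing_subr.
have nG := subsetP (center_sub G) _ nZn.
apply: (in_aug_center pk pH) => [|h hH|]; first exact: sub1H.
  rewrite mulrBl mulrBr mul1r mulr1; congr (_ - _).
  have hG := isom_inv_in isof (in_galg_delta k hH).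
  rewrite -(isom_invK isof (in_galg_delta k hH)) -!fM ?dG //; congr (f _).
  rewrite {1}(galg_sumG hG) [in RHS](galg_sumG hG) mulr_suml mulr_sumr.
  apply: eq_bigr => g gG; rewrite -scalerAl -scalerAr -!gdeltaM.
  by case/setIP: nZn => _ /centP ->.
(* [galg_isom] does not mention the augmentation. But y is nilpotent, and the trace formula with the
   constant form 1 makes the p^e-th power of the augmentation of y equal to the augmentation of
   y^(p^e) = 0. *)
have [e De] := p_natP (pG : p.-nat #|G|).
set y := f _ - 1; have yH : in_galg H y by apply: sub1H.
have y0 : y ^+ (p ^ e) = 0.
  by rewrite /y isom_deltaX // -De expg_cardG // gdelta1 f1 subrr.
have := @gtraceX_p k hT p pk H (fun=> 1) y e yH (fun _ _ _ _ => erefl).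
have -> : gtrace (fun=> 1) (y ^+ (p ^ e)) = 0 :> k.
  by rewrite y0 /gtrace big1 // => g _; rewrite ffunE mul0r.
rewrite /gtrace; under [X in _ = X]eq_bigr do rewrite mulr1.
rewrite -(sum_pX pk) => /esym/eqP; rewrite expf_eq0 => /andP[_ /eqP E].
by under eq_bigr do rewrite mulr1.
Qed.

(** The form [th] is the coefficient at 1 in kG, pulled back along f'. With p^e the exponent of M,
    it vanishes on (f(n) - 1)^(p^e), so n^(p^e) - 1 has coefficient 0 at 1, which forces n^(p^e) =
    1. *)
Lemma isom_sub_exponent N M : odd p -> cyclic H^`(1)%g -> N \subset G -> M <| H ->
  isom_sub N M -> (exponent N %| exponent M)%N.
Proof.
move=> p_odd cycH' sNG nM NM; apply/exponentP=> n nN.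
have nG := subsetP sNG _ nN.
have [e De] : exists e, exponent M = (p ^ e)%N.
  have pM := pgroupS (normal_sub nM) pH.
  have [y yM ->] := exponent_witness (pgroup_nil pM).
  exact: (order_pX pM).
rewrite De; pose th h : k := f' (gdelta k h) 1%g.
have f'L := isom_lin (galg_isom_sym isof).
have f'M := isomM (galg_isom_sym isof).
have thC : {in H &, forall g h, th (g * h)%g = th (h * g)%g}.
  move=> g h gH hH; rewrite /th !gdeltaM !f'M ?in_galg_delta //.
  rewrite !galgM [RHS](reindex_inj invg_inj) /=; apply: eq_bigr => y _.
  by rewrite !mulg1 invgK mulrC.
have thE (y : galg k hT) : in_galg H y -> gtrace th y = f' y 1%g.
  move=> yH; rewrite (isom_sumE (galg_isom_sym isof) yH) (gtrace_in _ yH) sum_ffunE.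
  by apply: eq_bigr => g _; rewrite ffunE.
have := gtrace_aug_exponent pk p_odd pH cycH' nM (_ : exponent M %| p ^ e)%N (NM n nN) thC.
rewrite De dvdnn => /(_ isT); rewrite isom_deltaX // thE; last first.
  by rewrite in_galgB ?in_galg1 ?fdH ?groupX.
rewrite -f1 -fB ?dG ?in_galg1 ?groupX // (isom_K isof) ?in_galgB ?dG ?in_galg1 ?groupX //.
rewrite !ffunE eqxx eq_sym; case: eqP => // _ /eqP.
by rewrite sub0r oppr_eq0 oner_eq0.
Qed.
End Char.
End Isom.

(** * Invariance of indices *)

Section Index.
Variables (k : fieldType) (gT hT : finGroupType) (G : {group gT}) (H : {group hT}).
Variables (f : galg k gT -> galg k hT) (f' : galg k hT -> galg k gT).
Hypothesis isof : galg_isom G H f f'.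
Implicit Types (N : {group gT}) (M : {group hT}).

Lemma gtrace_phi_sum (I : finType) (c : I -> k) (F : I -> hT -> k) (y : galg k hT) :
  gtrace (fun h => \sum_i c i * F i h) y = \sum_i c i * gtrace (F i) y.
Proof.
rewrite /gtrace; under eq_bigr do rewrite mulr_sumr.
rewrite exchange_big; apply: eq_bigr => i _; rewrite mulr_sumr.
by apply: eq_bigr => h _; rewrite mulrCA.
Qed.

(** f induces a surjection k[G/N] -> k[H/M], and A is its matrix on cosets. A vector v with vA = 0
    gives a function constant on the cosets of M that kills every f(g), hence all of kH by
    surjectivity; so v = 0. *)
Lemma isom_sub_index N M : N \subset G -> M \subset H ->
  isom_sub H f N M -> (#|H : M| <= #|G : N|)%N.
Proof.
move=> sNG sMH NM; pose ind (i : 'I_#|rcosets M H|) h : k := (h \in enum_val i)%:R.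
pose x (j : 'I_#|rcosets N G|) := repr (enum_val j).
pose A := \matrix_(i, j) gtrace (ind i) (f (gdelta k (x j))).
suff /eqP rk : row_free A by have := rank_leq_col A; rewrite rk.
apply: inj_row_free => v vA.
pose phi h := \sum_i v 0 i * ind i h.
have phi_inv : left_inv H M phi.
  move=> n g nM gH; apply: eq_bigr => i _; congr (_ * _%:R).
  have /rcosetsP[y yH ->] := enum_valP i.
  by rewrite !mem_rcoset -mulgA groupMl.
have phi_x j : gtrace phi (f (gdelta k (x j))) = 0.
  have := congr1 (fun B : 'rV_(_) => B 0 j) vA; rewrite !mxE => <-.
  by rewrite gtrace_phi_sum; apply: eq_bigr => i _; rewrite !mxE.
have phi_g g : g \in G -> gtrace phi (f (gdelta k g)) = 0.
  move=> gG; have gr : (N :* g)%g \in rcosets N G by apply/rcosetsP; exists g.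
  have := phi_x (enum_rank_in gr (N :* g)%g); rewrite /x enum_rankK_in //.
  have /rcosetP[n nN E] := mem_repr_rcoset N g; rewrite E => E0.
  have [_ /(_ _ phi_inv)] := isom_sub_delta isof sNG NM nN gG.
  have nG := subsetP sNG _ nN.
  rewrite (isomB isof) ?in_galg_delta ?groupM //.
  by rewrite gtraceB E0 sub0r => /eqP; rewrite oppr_eq0 => /eqP.
have phi_y y : y \in H -> phi y = 0.
  move=> yH; rewrite -gtrace_delta -(isom_invK isof (in_galg_delta k yH)).
  have aG := isom_inv_in isof (in_galg_delta k yH).
  by rewrite (isom_sumE isof aG) gtrace_sum big1 // => g gG; rewrite phi_g ?mulr0.
apply/rowP=> i; rewrite mxE; have := enum_valP i => /rcosetsP[y yH Ei].
have yi : y \in enum_val i by rewrite Ei rcoset_refl.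
rewrite -(phi_y y yH) /phi (bigD1 i) //= /ind yi mulr1 big1 ?addr0 // => j ji.
case yj : (y \in enum_val j); last by rewrite mulr0.
case/eqP: ji; apply: enum_val_inj.
have := enum_valP j => /rcosetsP[z zH Ej].
by move: yj; rewrite Ei Ej => /rcoset_eqP.
Qed.

End Index.

(** * Cyclicity of the derived subgroup *)

Section Cyclic.
Variables (k : fieldType) (gT hT : finGroupType) (G : {group gT}) (H : {group hT}).
Variables (f : galg k gT -> galg k hT) (f' : galg k hT -> galg k gT).
Hypothesis isof : galg_isom G H f f'.
Variable p : nat.
Hypotheses (pk : p \in [pchar k]) (pH : p.-group H).
Let p_pr := pcharf_prime pk.

(** A geometric sum: a^i g - g = (a - 1)(1 + a + ... + a^(i-1)) g. *)
Lemma aug_cycle a (x : galg k gT) : a \in G -> in_aug G <[a]>%G x ->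
  exists2 y, in_galg G y & x = (gdelta k a - 1) * y.
Proof.
move=> aG; have saG : <[a]> \subset G by rewrite cycle_subG.
apply: (@aug_ind k gT G <[a]>%G
  (fun x => exists2 y, in_galg G y & x = (gdelta k a - 1) * y) saG).
- by exists 0; rewrite ?mulr0 ?in_galg0.
- move=> c u v uG vG [y yG ->] [z zG ->]; exists (c *: y + z); first exact: in_galg_lin.
  by rewrite mulrDr -scalerAr.
move=> _ g /cycleP[i ->] gG.
exists ((\sum_(j < i) gdelta k a ^+ j) * gdelta k g).
  apply: in_galgM; last exact: in_galg_delta.
  by apply: in_galg_sum => j _; rewrite in_galgX ?in_galg_delta.
by rewrite mulrA -subrX1 mulrBl mul1r gdeltaM gdeltaX.
Qed.

(** P/M is cyclic of order p, so the discrete logarithm of a coset makes sense in k. *)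
Lemma maximal_char (P M : {group hT}) : p.-group P -> maximal M P ->
  exists phi : hT -> k, {in P &, forall g h, phi (g * h)%g = phi g + phi h} /\
    forall h, h \in P -> (phi h == 0) = (h \in M).
Proof.
move=> pP maxM; have nM := p_maximal_normal pP maxM.
have iM := p_maximal_index pP maxM.
have nMP := normal_norm nM.
have cQ : #|(P / M)%g| = p by rewrite card_quotient.
have /cyclicP[c Dc] : cyclic (P / M)%g by rewrite prime_cyclic ?cQ.
have oc : #[c] = p by rewrite orderE -Dc cQ.
have ex h : exists i, (h \in P) ==> (coset M h == c ^+ i)%g.
  have [hP|] := boolP (h \in P); last by exists 0.
  have /cycleP[i ->] : coset M h \in <[c]> by rewrite -Dc mem_quotient.
  by exists i; rewrite eqxx.
pose i h := xchoose (ex h).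
have iP h : h \in P -> coset M h = (c ^+ i h)%g.
  by move=> hP; apply/eqP; apply: (implyP (xchooseP (ex h))).
have kE m n : (m%:R == n%:R :> k) = (m == n %[mod p])%N.
  wlog mn : m n / (m <= n)%N.
    by move=> W; case: (leqP m n) => [|/ltnW] /W // E; rewrite eq_sym E eq_sym.
  rewrite eq_sym -subr_eq0 -natrB // -(dvdn_pcharf pk) eq_sym.
  by rewrite eqn_mod_dvd.
exists (fun h => (i h)%:R); split=> [g h gP hP|h hP].
  apply/eqP; rewrite -natrD kE -oc -eq_expg_mod_order expgD -!iP ?groupM //.
  by rewrite (morphM (coset_morphism M)) ?(subsetP nMP).
rewrite -(mulr0n 1) kE -oc -eq_expg_mod_order expg0 -iP //.
apply/eqP/idP => [|/coset_id//]; apply: coset_idr.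
exact: (subsetP nMP).
Qed.

(** As P is not cyclic, any x outside M1 lies in some maximal M2; both have index p, so M1 is not
    contained in M2. *)
Lemma noncyclic_maximal (P : {group hT}) : p.-group P -> ~~ cyclic P ->
  exists M1 M2 : {group hT}, exists x y, [/\ maximal M1 P, maximal M2 P,
    x \in P :\: M1, x \in M2 & y \in M1 /\ y \in P :\: M2].
Proof.
move=> pP ncP.
have max (x : hT) : x \in P -> exists2 M : {group hT}, maximal M P & x \in M.
  move=> xP; have sx : <[x]> \subset P by rewrite cycle_subG.
  have [E|[M maxM]] := maximal_exists sx.
    by case/negP: ncP; rewrite -E cycle_cyclic.
  by rewrite cycle_subG; exists M.
have [M1 maxM1 _] := max _ (group1 P).
have /properP[sM1 [x xP xM1]] := maxgroupp maxM1.
have [M2 maxM2 xM2] := max _ xP.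
have /properP[sM2 _] := maxgroupp maxM2.
have : ~~ (M1 \subset M2).
  apply: contra xM1 => s12; suff -> : M1 :=: M2 by [].
  apply/eqP; rewrite eqEcard s12.
  have := Lagrange sM1; rewrite (p_maximal_index pP maxM1) => E1.
  have := Lagrange sM2; rewrite (p_maximal_index pP maxM2) -E1 => /eqP.
  by rewrite eqn_pmul2r ?prime_gt0 // => /eqP ->; rewrite leqnn.
case/subsetPn=> y yM1 yM2; exists M1, M2, x, y.
by rewrite !inE xM1 xP yM2 (subsetP sM1).
Qed.

(** [lam g] is phi of the P-part of g relative to a coset representative, so lam(ng) = phi(n) +
    lam(g). Then lam(gh) - lam(g) is constant on the cosets of P and vanishes on I(P)kH: right
    multiplication by h is invisible to lam there, and that by y acts through its augmentation. *)
Lemma gtrace_aug_hom (P : {group hT}) (phi : hT -> k) : P \subset H ->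
  {in P &, forall g h, phi (g * h)%g = phi g + phi h} ->
  exists lam : hT -> k,
    (forall (s y : galg k hT), in_aug H P s -> in_galg H y ->
       gtrace lam (s * y) = gtrace lam s * gtrace (fun=> 1) y) /\
    forall h, h \in P -> gtrace lam (gdelta k h - 1) = phi h.
Proof.
move=> sPH phiM; pose lam g := phi (g * (repr (P :* g))^-1)%g.
have inP g : (g * (repr (P :* g))^-1 \in P)%g.
  have /rcosetP[n nP ->] := mem_repr_rcoset P g.
  by rewrite invMg mulgA mulgV mul1g groupV.
have lamM n g : n \in P -> lam (n * g)%g = phi n + lam g.
  by move=> nP; rewrite /lam rcosetM rcoset_id // -mulgA phiM.
exists lam; split=> [s y [sH s0] yH|h hP]; last first.
  by rewrite gtraceB -gdelta1 !gtrace_delta -[h]mulg1 lamM // mulg1 addrK.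
rewrite gtraceMr [X in _ = _ * X]/gtrace mulr_sumr; apply: eq_bigr => h _.
rewrite mulr1 mulrC; congr (_ * _).
apply/eqP; rewrite -subr_eq0 /gtrace -sumrB.
rewrite -[X in _ == X](s0 (fun g => lam (g * h)%g - lam g)) => [|n g nP gH].
  by apply/eqP; apply: eq_bigr => g _; rewrite -mulrBr.
by rewrite -mulgA !(lamM n) // opprD addrACA subrr add0r.
Qed.

(* I(G')kG = (a - 1)kG is principal, whereas two distinct maximal subgroups of a
   noncyclic H' would give two functionals that rule out a single generator. *)
Lemma isom_der1_cyclic : cyclic G^`(1) -> cyclic H^`(1).
Proof.
case/cyclicP=> a Da; apply: contraT => ncH'.
have aG : a \in G by rewrite (subsetP (der_sub 1 G)) // Da cycle_id.
have pH' : p.-group H^`(1)%g := pgroupS (der_sub 1 H) pH.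
have [M1 [M2 [x [y [max1 max2 /setDP[xP xM1] xM2 [yM1 /setDP[yP yM2]]]]]]] :=
  noncyclic_maximal pH' ncH'.
have [phi1 [phi1M phi1E]] := maximal_char pH' max1.
have [phi2 [phi2M phi2E]] := maximal_char pH' max2.
have [l1 [l1M l1E]] := gtrace_aug_hom (der_sub 1 H) phi1M.
have [l2 [l2M l2E]] := gtrace_aug_hom (der_sub 1 H) phi2M.
set s := f (gdelta k a) - 1.
have sI : in_aug H (H^`(1))%G s by apply: (isom_sub_der1 isof); rewrite /= Da cycle_id.
have gen h : h \in H^`(1)%g -> exists2 b, in_galg H b & gdelta k h - 1 = s * b.
  move=> hP; have hH := subsetP (der_sub 1 H) _ hP.
  have := isom_sub_der1 (galg_isom_sym isof) hP.
  have -> : (G^`(1))%G = <[a]>%G by apply: group_inj.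
  case/(aug_cycle aG)=> b bG E; exists (f b); first exact: (isom_in isof).
  have daG : in_galg G (gdelta k a - 1) by rewrite in_galgB ?in_galg1 ?in_galg_delta.
  have <- : f (gdelta k a - 1) = s by rewrite (isomB isof) ?in_galg1 ?in_galg_delta // (isom1 isof).
  rewrite -(isomM isof) // -E (isomB isof) ?in_galg1 ?(isom_inv_in isof) ?in_galg_delta //.
  by rewrite (isom_invK isof) ?in_galg_delta // (isom1 isof).
have [bx bxH Ex] := gen x xP; have [b bH Ey] := gen y yP.
have := l1E x xP; rewrite Ex l1M // => E1x.
have := l2E x xP; rewrite Ex l2M // => E2x.
have := l2E y yP; rewrite Ey l2M // => E2y.
(* As x is outside M1, the cofactor bx has nonzero augmentation; as x lies in M2, l2 must then
   vanish on s. This gives phi2 y = 0, although y is outside M2. *)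
have := phi1E x xP; rewrite -E1x (negbTE xM1) mulf_eq0 => /norP[_ ex0].
have := phi2E x xP; rewrite -E2x xM2 mulf_eq0 (negbTE ex0) orbF => /eqP l20.
by have := phi2E y yP; rewrite -E2y l20 mul0r eqxx (negbTE yM2).
Qed.
End Cyclic.

Local Close Scope ring_scope.

(** * Recovering C from Z(G)G' *)

Section SplitGen.
Variables (gT : finGroupType) (G : {group gT}) (p : nat).
Hypotheses (p_odd : odd p) (pG : p.-group G) (p_pr : prime p).
Hypotheses (cycG' : cyclic G^`(1)) (G2 : two_generated G).
Local Notation C := 'C_G(G^`(1)).

(** Of two generators, the one of smaller order modulo C is moved into C by a power of the other. *)
Lemma split_exists : exists b u, G :=: <<[set b; u]>> /\ u \in C.
Proof.
case: G2 => -[x [y [xG yG defG]]] _.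
have key v w : v \in G -> w \in G -> G :=: <<[set v; w]>> ->
    #[coset C w] %| #[coset C v] -> exists b u, G :=: <<[set b; u]>> /\ u \in C.
  move=> vG wG defG' dv.
  have [j jC] := mulX_cent p_odd pG p_pr cycG' wG vG dv.
  exists v, (w * v ^+ j); split=> //.
  apply/eqP; rewrite eqEsubset gen_subG subUset !sub1set vG groupM ?groupX // andbT.
  rewrite {1}defG' gen_subG subUset !sub1set mem_gen ?set21 //=.
  rewrite -[X in X \in _](mulgK (v ^+ j)).
  by rewrite groupM ?groupV ?groupX ?mem_gen ?set21 ?set22.
have oX z : z \in G -> exists n, #[coset C z] = (p ^ n)%N.
  by move=> zG; apply: (order_pX (quotient_pgroup C pG)); apply: mem_quotient.
have [[i Di] [j Dj]] := (oX x xG, oX y yG).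
case: (leqP j i) => [ji|/ltnW ij].
  by apply: (key x y xG yG defG); rewrite Di Dj dvdn_exp2l.
by apply: (key y x yG xG); [rewrite setUC | rewrite Di Dj dvdn_exp2l].
Qed.

Lemma cent_der1_relOhm (q := #|G^`(1)| %/ #|G : C|) :
  'C_G(G^`(1))%G = [group of relOhm q G ('Z(G) <*> G^`(1))].
Proof.
have [b [u [defG uC]]] := split_exists.
apply/group_inj/setP=> x; have sG' : G^`(1) \subset ('Z(G) <*> G^`(1))%G := joing_subr _ _.
rewrite (mem_relOhm sG'); have [xG|xG] := boolP (x \in G); last first.
  by rewrite in_setI (negbTE xG).
exact: (split_cent_root p_odd pG p_pr cycG' defG uC).
Qed.

Lemma index_cent_der1_dvd : #|G : C| %| #|G^`(1)|.
Proof.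
have [b [u [defG uC]]] := split_exists.
exact: (split_index_dvd p_odd pG p_pr cycG' defG uC).
Qed.

(** |G : Z(G)G'| = |G'| q and |G'| = |G:C| q; eliminating q leaves quantities determined by kG. *)
Lemma index_cent_der1 :
  #|G : C| = (#|G^`(1)| %/ (#|G : ('Z(G) <*> G^`(1))%G| %/ #|G^`(1)|))%N.
Proof.
have [b [u [defG uC]]] := split_exists.
rewrite (split_center_index p_odd pG p_pr cycG' defG uC) mulKn ?cardG_gt0 //.
have [o Do] := dvdnP index_cent_der1_dvd; rewrite {1 2}Do mulnK ?indexg_gt0 //.
by rewrite mulKn // -(ltn_pmul2r (indexg_gt0 G 'C_G(G^`(1))%G)) -Do cardG_gt0.
Qed.
End SplitGen.

(** * Corresponding subgroups of G and H *)

Section Corr.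
Variables (k : fieldType) (gT hT : finGroupType) (G : {group gT}) (H : {group hT}).
Variables (f : galg k gT -> galg k hT) (f' : galg k hT -> galg k gT).
Hypothesis isof : galg_isom G H f f'.
Variable p : nat.
Hypotheses (pk : (p \in [pchar k])%R) (pG : p.-group G) (pH : p.-group H).
Let p_pr := pcharf_prime pk.
Let isof' := galg_isom_sym isof.
Implicit Types (N : {group gT}) (M : {group hT}).

(** f carries I(N)kG onto I(M)kH. This is canonicity relative to one fixed isomorphism. *)
Definition corr (N : {group gT}) (M : {group hT}) :=
  [/\ N <| G, M <| H, isom_sub H f N M & isom_sub G f' M N].

Lemma corr_index N M : corr N M -> #|H : M| = #|G : N|.
Proof.
case=> nN nM NM MN; apply/eqP; rewrite eqn_leq.
rewrite (isom_sub_index isof (normal_sub nN) (normal_sub nM) NM).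
by rewrite (isom_sub_index isof' (normal_sub nM) (normal_sub nN) MN).
Qed.

Lemma corr1 : corr 1%G 1%G.
Proof.
split; rewrite ?normal1 // => n /set1P ->; rewrite gdelta1.
  by rewrite (isom1 isof) subrr; apply: in_aug0.
by rewrite (isom1 isof') subrr; apply: in_aug0.
Qed.

Lemma corr_der1 : corr (G^`(1))%G (H^`(1))%G.
Proof.
split; rewrite ?der_normal //; first exact: (isom_sub_der1 isof).
exact: (isom_sub_der1 isof').
Qed.

Lemma corr_center : corr ('Z(G) <*> G^`(1))%G ('Z(H) <*> H^`(1))%G.
Proof.
split; rewrite /= ?normalY ?center_normal ?der_normal //.
  exact: (isom_sub_center isof pk pG pH).
exact: (isom_sub_center isof' pk pH pG).
Qed.

Lemma corrY N N' M M' : corr N M -> corr N' M' -> corr (N <*> N')%G (M <*> M')%G.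
Proof.
case=> nN nM NM MN [nN' nM' NM' MN']; split; rewrite /= ?normalY //.
  by apply: (isom_subY isof) => //; apply: normal_sub.
by apply: (isom_subY isof') => //; apply: normal_sub.
Qed.

Lemma corr_relOhm e N M : G^`(1) \subset N -> H^`(1) \subset M -> corr N M ->
  corr [group of relOhm (p ^ e) G N] [group of relOhm (p ^ e) H M].
Proof.
move=> sN sM [nN nM NM MN]; split; rewrite ?relOhm_normal //.
  exact: (isom_sub_root isof pk).
exact: (isom_sub_root isof' pk).
Qed.

Lemma corr_card N M : corr N M -> #|H| = #|G| -> #|M| = #|N|.
Proof.
move=> c cHG; have := corr_index c; case: c => nN nM _ _ e.
have := Lagrange (normal_sub nM); rewrite e cHG -(Lagrange (normal_sub nN)).
by move/eqP; rewrite eqn_pmul2r ?indexg_gt0 // => /eqP.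
Qed.

Lemma corr_exponent N M : odd p -> cyclic G^`(1) -> cyclic H^`(1) -> corr N M ->
  exponent M = exponent N.
Proof.
move=> p_odd cG cH [nN nM NM MN]; apply/eqP; rewrite eqn_dvd.
rewrite (isom_sub_exponent isof' pk pG p_odd cG (normal_sub nM) nN MN).
by rewrite (isom_sub_exponent isof pk pH p_odd cH (normal_sub nN) nM NM).
Qed.
End Corr.

(** This turns the exponent of G/G' into an index, which [corr_index] can compare. *)
Lemma exponent_der1_quotient (gT : finGroupType) (G : {group gT}) n :
  (exponent (G / G^`(1)) %| n) = (#|G : relOhm n G G^`(1)| == 1%N).
Proof.
rewrite indexg_eq1; apply/exponentP/subsetP=> E x xG.
  rewrite mem_relOhm // xG -(dvdn_order_coset _ (der_normal 1 G) xG) order_dvdn.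
  by rewrite E ?mem_quotient // eqxx.
case/morphimP: xG => g gN gG ->; apply/eqP; rewrite -order_dvdn.
rewrite (dvdn_order_coset _ (der_normal 1 G) gG).
by have := E g gG; rewrite mem_relOhm // => /andP[].
Qed.

(** N1, N2 and |DC:C| are rewritten without the basis, and with indices in the whole of G, the form
    in which [corr_index] gives invariance. *)
Lemma min_basis_Oinv (gT : finGroupType) (G : {group gT}) p : odd p -> p.-group G ->
  prime p -> cyclic G^`(1) -> two_generated G ->
  let N1 := exponent (G / G^`(1)) in let N2 := #|G : G^`(1)| %/ N1 in
  let C := 'C_G(G^`(1))%G in let D := [group of relOhm N2 G G^`(1)] in
  Oinv G = Some (Oform #|G : C| (#|G : C| %/ #|G : D <*> C|) (N1 %/ N2)
    (exponent G) (exponent C) (exponent D)).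
Proof.
move=> p_odd pG p_pr cycG' G2 N1 N2 C D.
have [[b1 b2] minb ->] := Oinv_min (rank2_basis (two_generated_rank pG G2)).
rewrite (min_basis_Oform p_odd pG p_pr cycG' minb); congr Some.
have bb := minb.1; have [b1G b2G _ cQ _] := basisP bb.
have EN1 : N1 = #[coset G^`(1) b1] by rewrite /N1 (basis_exponent bb).
have EN2 : N2 = #[coset G^`(1) b2] by rewrite /N2 EN1 cQ mulKn ?order_gt0.
rewrite -EN1 -EN2; congr (Oform _ _ _ _ _ _).
have sD : D <*> C \subset G by rewrite join_subG relOhm_sub ?subsetIl.
have := Lagrange_index sD (joing_subr D C) => <-.
by rewrite mulKn ?indexg_gt0.
Qed.

Theorem theoremB (k : fieldType) (p : nat) (gT hT : finGroupType)
  (G : {group gT}) (H : {group hT}) :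
  prime p -> (p \in [pchar k])%R -> odd p ->
  (p.-group G)%g -> (p.-group H)%g ->
  galg_iso k G H ->
  two_generated G -> cyclic G^`(1)%g ->
  [/\ two_generated H, cyclic H^`(1)%g & Oinv G = Oinv H].
Proof.
move=> p_pr pk p_odd pG pH /galg_iso_isom[f [f' isof]] G2 cycG'.
have cycH' := isom_der1_cyclic isof pk pH cycG'.
have cHG : #|H| = #|G| by have := corr_index isof (corr1 isof); rewrite !indexg1.
have cD := corr_der1 isof.
have cD' : #|H^`(1)| = #|G^`(1)| := corr_card isof cD cHG.
have idx' := corr_index isof cD.
have cO e := corr_relOhm isof pk e (subxx _) (subxx _) cD.
have H2 : two_generated H.
  apply: (basis_two_generated pH); rewrite -(two_generated_rank pG G2).
  rewrite (rank_der1_quotient pH) (rank_der1_quotient pG).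
  have := corr_index isof (cO 1%N); rewrite expn1 => e.
  have sG := relOhm_sub (subxx G^`(1)) p; have sH := relOhm_sub (subxx H^`(1)) p.
  have := Lagrange_index sH (relOhm_der1 (subxx _) p).
  rewrite e idx' -(Lagrange_index sG (relOhm_der1 (subxx _) p)) => /eqP.
  by rewrite eqn_pmul2l ?indexg_gt0 // => /eqP ->.
have cZ := corr_center isof pk pG pH.
have eC : #|H : 'C_H(H^`(1))| = #|G : 'C_G(G^`(1))|.
  rewrite (index_cent_der1 p_odd pH p_pr cycH' H2) (index_cent_der1 p_odd pG p_pr cycG' G2).
  by rewrite cD' (corr_index isof cZ).
have cC : corr G H f f' 'C_G(G^`(1))%G 'C_H(H^`(1))%G.
  rewrite (cent_der1_relOhm p_odd pG p_pr cycG' G2) (cent_der1_relOhm p_odd pH p_pr cycH' H2).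
  rewrite cD' eC.
  have [e ->] : exists e, (#|G^`(1)| %/ #|G : 'C_G(G^`(1))|)%N = (p ^ e)%N.
    have dv := dvdn_div (index_cent_der1_dvd p_odd pG p_pr cycG' G2).
    have [e ->] := p_natP (pnat_dvd dv (pgroupS (der_sub 1 G) pG : p.-nat _)).
    by exists e.
  apply: (corr_relOhm isof pk e) => //; exact: joing_subr.
have expX (rT : finGroupType) (K : {group rT}) : p.-group K ->
    exists e, exponent (K / K^`(1)) = (p ^ e)%N.
  move=> pK; have pQ := quotient_pgroup K^`(1) pK.
  by have [x xQ ->] := exponent_witness (pgroup_nil pQ); apply: (order_pX pQ xQ).
have [[i Di] [j Dj]] := (expX _ _ pG, expX _ _ pH).
have idxO e := corr_index isof (cO e).
have eN1 : exponent (H / H^`(1)) = exponent (G / G^`(1)).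
  apply/eqP; rewrite eqn_dvd {1}Di {2}Dj !exponent_der1_quotient.
  by rewrite (idxO i) -(idxO j) -!exponent_der1_quotient -Di -Dj !dvdnn.
have [e De] : exists e, (#|G : G^`(1)| %/ exponent (G / G^`(1)))%N = (p ^ e)%N.
  have dv : exponent (G / G^`(1)) %| #|G : G^`(1)|.
    by rewrite -card_quotient ?der_norm // exponent_dvdn.
  have [e ->] := p_natP (pnat_dvd (dvdn_trans (dvdn_div dv) (dvdn_indexg _ _)) (pG : p.-nat _)).
  by exists e.
(* With p^i the exponent of G/G', every element of G is a p^i-th root of G', so the whole groups
   correspond as root subgroups. *)
have cG : corr G H f f' G H.
  have EG : [group of relOhm (p ^ i) G G^`(1)] = G.
    apply/group_inj/eqP; rewrite eqEsubset relOhm_sub //=.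
    by rewrite -indexg_eq1 -exponent_der1_quotient Di.
  have EH : [group of relOhm (p ^ i) H H^`(1)] = H.
    apply/group_inj/eqP; rewrite eqEsubset relOhm_sub //=.
    by rewrite -indexg_eq1 -exponent_der1_quotient eN1 Di.
  by have := cO i; rewrite EG EH.
split=> //.
rewrite (min_basis_Oinv p_odd pG p_pr cycG' G2) (min_basis_Oinv p_odd pH p_pr cycH' H2).
rewrite eN1 idx' De eC (corr_index isof (corrY isof (cO e) cC)).
have E := corr_exponent isof pk pG pH p_odd cycG' cycH'.
by rewrite (E _ _ cG) (E _ _ cC) (E _ _ (cO e)).
Qed.
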